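(* Let $D$ be a $2$-dimensional regular local ring with maximal ideal $\mathfrak{m}_D=(x,y)D$ and with an algebraically closed coefficient field $k$. For each $a\in k$ let $$\alpha_a=D\Big[\tfrac{x+ay}{y}\Big]_{(y,\frac{x+ay}{y})},\qquad \beta_a=\alpha_a\Big[\tfrac{y^2}{x+ay}\Big]_{(\frac{x+ay}{y},\frac{y^2}{x+ay})},$$ (localizations at the ideals generated by the indicated elements), and let $B=\bigcap_{a\in k}\beta_a$. Then $B$ is an almost Krull domain that is not Noetherian, and the family $\{\beta_a: a\in k\}$ defines an irredundant essential representation of $B$.
   Context: A coefficient field of $D$ is a subfield $k\subseteq D$ mapping isomorphically onto $D/\mathfrak{m}_D$. An integral domain $B$ is an almost Krull domain if $B_P$ is a Krull domain for every prime ideal $P$ of $B$. The representation $B=\bigcap_{a\in k}\beta_a$ is irredundant if for every $b\in k$, $\bigcap_{a\neq b}\beta_a\neq B$; it is essential if each $\beta_a$ is a localization of $B$ at a prime ideal of $B$. *)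

(* Defs.v *)
(* All rings are represented as subrings of a fixed field K
   (the fraction field of D), given as predicates K -> Prop. *)
From Stdlib Require List.
From HB Require Import structures.
From mathcomp Require Import all_boot all_order all_algebra.
Set Implicit Arguments. Unset Strict Implicit. Unset Printing Implicit Defensive.
Import Order.TTheory GRing.Theory Num.Theory.
Local Open Scope ring_scope.

Section Defs.
Variable K : fieldType.
Implicit Types (R I F k : K -> Prop).

Definition is_subring R : Prop :=
  [/\ R 0, R 1, (forall a b, R a -> R b -> R (a - b)) &
      (forall a b, R a -> R b -> R (a * b))].

Definition frac R : K -> Prop :=
  fun z => exists a b, [/\ R a, R b, b != 0 & z = a / b].

Definition is_ideal R I : Prop :=
  [/\ (forall z, I z -> R z), I 0, (forall a b, I a -> I b -> I (a + b)) &
      (forall r a, R r -> I a -> I (r * a))].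

Definition is_prime_ideal R I : Prop :=
  [/\ is_ideal R I, ~ I 1 &
      (forall a b, R a -> R b -> I (a * b) -> I a \/ I b)].

Definition ideal_gen R (s : seq K) : K -> Prop :=
  fun z => exists c : seq K, [/\ size c = size s, (forall r, List.In r c -> R r) &
                              z = \sum_(i < size s) c`_i * s`_i].

Definition ideal2 R (g1 g2 : K) : K -> Prop := ideal_gen R [:: g1; g2].

Definition is_noetherian R : Prop :=
  is_subring R /\
  forall I, is_ideal R I ->
    exists s : seq K, (forall g, List.In g s -> R g) /\
                      (forall z, I z <-> ideal_gen R s z).

Definition prime_lt R (P Q : K -> Prop) : Prop :=
  [/\ is_prime_ideal R P, is_prime_ideal R Q, (forall z, P z -> Q z) &
      (exists z, Q z /\ ~ P z)].

Definition krull_dim_eq2 R : Prop :=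
  (exists P0 P1 P2, prime_lt R P0 P1 /\ prime_lt R P1 P2) /\
  ~ (exists P0 P1 P2 P3, [/\ prime_lt R P0 P1, prime_lt R P1 P2 & prime_lt R P2 P3]).

Definition is_local_with_max R m : Prop :=
  is_ideal R m /\ forall d, R d -> (m d <-> ~ (d != 0 /\ R d^-1)).

Definition regular_local_dim2 (D : K -> Prop) (x y : K) : Prop :=
  [/\ is_noetherian D, (forall z, frac D z), D x /\ D y,
      is_local_with_max D (ideal2 D x y) & krull_dim_eq2 D].

Definition is_subfield k : Prop :=
  is_subring k /\ forall a, k a -> a != 0 -> k a^-1.

Definition alg_closed_sub k : Prop :=
  forall p : {poly K}, (forall i, k p`_i) -> (1 < size p)%N ->
    exists c, k c /\ root p c.

Definition coefficient_field (D m k : K -> Prop) : Prop :=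
  [/\ is_subfield k, (forall c, k c -> D c),
      (forall d, D d -> exists c, k c /\ m (d - c)) &
      (forall c, k c -> m c -> c = 0)].

Definition adjoin R (t : K) : K -> Prop :=
  fun z => exists p : {poly K}, (forall i, R p`_i) /\ z = p.[t].

Definition localize R I : K -> Prop :=
  fun z => exists r s, [/\ R r, R s, ~ I s & z = r / s].

Definition is_dval (F : K -> Prop) (v : K -> int) : Prop :=
  [/\ (forall a b, F a -> F b -> a != 0 -> b != 0 -> v (a * b) = v a + v b),
      (forall a b, F a -> F b -> a != 0 -> b != 0 -> a + b != 0 ->
         Num.min (v a) (v b) <= v (a + b)) &
      (exists t, [/\ F t, t != 0 & v t = 1])].

Definition is_krull R : Prop :=
  is_subring R /\
  exists (I : Type) (v : I -> K -> int),
    [/\ (forall i, is_dval (frac R) (v i)),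
        (forall z, R z <-> frac R z /\ forall i, z = 0 \/ 0 <= v i z) &
        (forall z, frac R z -> z != 0 ->
           exists s : seq I, forall i, v i z != 0 -> List.In i s)].

Definition almost_krull R : Prop :=
  is_subring R /\ forall P, is_prime_ideal R P -> is_krull (localize R P).

Definition alpha (D : K -> Prop) (x y a : K) : K -> Prop :=
  let u := (x + a * y) / y in
  localize (adjoin D u) (ideal2 (adjoin D u) y u).

Definition beta (D : K -> Prop) (x y a : K) : K -> Prop :=
  let u := (x + a * y) / y in
  let w := y ^+ 2 / (x + a * y) in
  localize (adjoin (alpha D x y a) w) (ideal2 (adjoin (alpha D x y a) w) u w).

End Defs.

(* Main.v *)
Require Import Defs.
From Stdlib Require Import Classical ClassicalEpsilon FunctionalExtensionality ProofIrrelevance.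
From mathcomp Require Import all_boot all_order all_algebra.
From mathcomp Require Import ring zify.
Set Implicit Arguments. Unset Strict Implicit. Unset Printing Implicit Defensive.
Import Order.TTheory GRing.Theory Num.Theory.
Local Open Scope ring_scope.

(** Write t = x/y, u_a = t + a and w_a = y/u_a. Passing from a two-dimensional regular local ring
with parameters p, q to R[q/p] localized at (p, q/p) preserves regularity, because R[q/p]/(p) is the
polynomial ring k[T]. Hence beta_a is a two-dimensional regular local ring with parameters u_a, w_a.
Such a ring is factorial: if r is irreducible and not divisible by the parameter u, then an ideal
(r : a) is principal modulo u, hence principal by Nakayama.

All beta_a lie in the valuation ring V of the order valuation, the localization of D[t] at (y), whose
residue field is k(t). The residue of an element of B has no pole at any point -a of the affine
line, so it is a polynomial, B/(B cap yV) = k[t], and an element of B whose residue is a nonzero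
constant is a unit in every beta_a. Thus the maximal ideals of B are the centers M_a of the beta_a,
one for each point of the line, and since u_a and w_a are in B, B localized at M_a is beta_a. So
every localization of B at a prime is a localization of some factorial beta_a, hence Krull. The
element 1/u_b belongs to beta_a exactly for a <> b, and the elements of B divisible by y in almost
all beta_a form an ideal containing all w_b = y (1/u_b), hence not finitely generated. *)

(** * Closure properties of subrings of a field *)

Section Subrings.
Variable K : fieldType.
Implicit Types (R I J Q : K -> Prop) (p q u w z : K).

Section Closure.
Variables (R : K -> Prop) (subR : is_subring R).

Lemma subring0 : R 0. Proof. by case: subR. Qed.
Lemma subring1 : R 1. Proof. by case: subR. Qed.
Lemma subringB a b : R a -> R b -> R (a - b). Proof. by case: subR => _ _ + _; apply. Qed.
Lemma subringM a b : R a -> R b -> R (a * b). Proof. by case: subR => _ _ _; apply. Qed.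
Lemma subringN a : R a -> R (- a).
Proof. by rewrite -sub0r; apply: subringB; apply: subring0. Qed.
Lemma subringD a b : R a -> R b -> R (a + b).
Proof. by move=> Ra Rb; rewrite -[b]opprK; apply: subringB => //; apply: subringN. Qed.
Lemma subringX a n : R a -> R (a ^+ n).
Proof.
move=> Ra; elim: n => [|n IH]; first by rewrite expr0; apply: subring1.
by rewrite exprS; apply: subringM.
Qed.
Lemma subring_sum (T : Type) (r : seq T) (P : pred T) (F : T -> K) :
  (forall i, P i -> R (F i)) -> R (\sum_(i <- r | P i) F i).
Proof. by move=> RF; apply: big_ind => //; [apply: subring0 | apply: subringD]. Qed.

End Closure.

End Subrings.

Ltac mem subR := intros; repeat first [assumption | apply: (subring0 subR) | apply: (subring1 subR)
  | apply: (subringD subR) | apply: (subringN subR) | apply: (subringM subR)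
  | apply: (subringX subR)].

(** * Divisibility, local rings with two generators of the maximal ideal, finite spans and
    Nakayama's lemma *)

Section Ideals.
Variable K : fieldType.
Implicit Types (R I J Q : K -> Prop) (p q u w z : K).

Definition rdvd R a b := exists2 c, R c & b = a * c.

Definition unit_in R e := [/\ R e, e != 0 & R e^-1].

Definition prime_elt R p :=
  [/\ R p, p != 0, ~ rdvd R p 1 &
      forall a b, R a -> R b -> rdvd R p (a * b) -> rdvd R p a \/ rdvd R p b].

Definition comb R p q z := exists a b, [/\ R a, R b & z = a * p + b * q].

(** A local ring whose maximal ideal is [(p, q)]: this ideal is proper and contains every
    nonunit. *)
Definition local2 R p q :=
  [/\ is_subring R, R p /\ R q, ~ comb R p q 1 &
      forall r, R r -> unit_in R r \/ comb R p q r].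

(** The linear span is defined by recursion on the list instead of by an indexed sum, so that
    generators can be split off one at a time. *)
Fixpoint rspan R (s : seq K) (z : K) : Prop :=
  if s is g :: s' then exists c, R c /\ rspan R s' (z - c * g) else z = 0.

(** The generators are taken in [J], so the inclusion of their span in [J] is [rspan_sub] and only
    the other inclusion is recorded. *)
Definition noeth R :=
  forall J, is_ideal R J ->
    exists s : seq K, (forall g, g \in s -> J g) /\ (forall z, J z -> rspan R s z).

Lemma ideal2E R p q z : ideal2 R p q z <-> comb R p q z.
Proof.
split.
  case=> c [sc Rc ->]; case: c sc Rc => [|a [|b [|]]] //= _ Rc.
  exists a, b; split; [by apply: Rc; left | by apply: Rc; right; left |].
  by rewrite big_ord_recr /= big_ord_recr /= big_ord0 /= add0r.
move=> [a [b [Ra Rb ->]]]; exists [:: a; b]; split=> //=.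
  by move=> r [<-|[<-|]].
by rewrite big_ord_recr /= big_ord_recr /= big_ord0 /= add0r.
Qed.

Lemma combC R p q z : comb R p q z -> comb R q p z.
Proof. by move=> [a [b [Ra Rb ->]]]; exists b, a; rewrite addrC. Qed.

Lemma local2C R p q : local2 R p q -> local2 R q p.
Proof.
move=> [subR [Rp Rq] n1 loc]; split=> //; first by move/combC.
by move=> r /loc [|/combC]; [left | right].
Qed.

Section Span.
Variables (R : K -> Prop) (subR : is_subring R).

Lemma rspan0 s : rspan R s 0.
Proof.
by elim: s => //= g s IH; exists 0; rewrite mul0r subr0; split=> //; apply: subring0.
Qed.

Lemma rspanD s z z' : rspan R s z -> rspan R s z' -> rspan R s (z + z').
Proof.
elim: s z z' => [|g s IH] z z' /=; first by move=> -> ->; rewrite addr0.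
move=> [c [Rc sz]] [c' [Rc' sz']]; exists (c + c'); split; first by mem subR.
by have -> : z + z' - (c + c') * g = (z - c * g) + (z' - c' * g) by [ring]; apply: IH.
Qed.

Lemma rspanZ s a z : R a -> rspan R s z -> rspan R s (a * z).
Proof.
move=> Ra; elim: s z => [|g s IH] z /=; first by move=> ->; rewrite mulr0.
move=> [c [Rc sz]]; exists (a * c); split; first by mem subR.
by have -> : a * z - a * c * g = a * (z - c * g) by [ring]; apply: IH.
Qed.

Lemma rspan_cat s1 s2 z1 z2 : rspan R s1 z1 -> rspan R s2 z2 -> rspan R (s1 ++ s2) (z1 + z2).
Proof.
elim: s1 z1 => [|g s IH] z1 /=; first by move=> ->; rewrite add0r.
move=> [c [Rc sz]] sz2; exists c; split=> //.
by rewrite addrAC; apply: IH.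
Qed.

Lemma rspan_mem s g : g \in s -> rspan R s g.
Proof.
elim: s => //= h s IH; rewrite inE => /predU1P [->|/IH sg].
  by exists 1; rewrite mul1r subrr; split; [mem subR | apply: rspan0].
by exists 0; rewrite mul0r subr0; split; [mem subR |].
Qed.

Lemma rspan_sub s J z : is_ideal R J -> (forall g, g \in s -> J g) -> rspan R s z -> J z.
Proof.
move=> [_ J0 JD JM]; elim: s z => [|g s IH] z Js /=; first by move=> ->.
move=> [c [Rc sz]]; rewrite -(subrK (c * g) z); apply: JD.
  by apply: IH sz => h hs; apply: Js; rewrite inE hs orbT.
by apply: JM => //; apply: Js; rewrite inE eqxx.
Qed.

End Span.

Lemma rspan_mono R R' s z : (forall a, R a -> R' a) -> rspan R s z -> rspan R' s z.
Proof.
move=> RR'; elim: s z => //= g s IH z [c [Rc sz]].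
by exists c; split; [apply: RR' | apply: IH].
Qed.

Lemma ideal_gen_span R s z : is_subring R -> ideal_gen R s z -> rspan R s z.
Proof.
move=> subR [c [sc Rc ->]]; elim: s c sc Rc => [|g s IH] [|a c] //= sc Rc.
  by rewrite big_ord0.
exists a; split; first by apply: Rc; left.
rewrite big_ord_recl /= addrC addKr; apply: IH; first by case: sc.
by move=> r cr; apply: Rc; right.
Qed.

Lemma rspan_ideal_gen R s z : rspan R s z -> ideal_gen R s z.
Proof.
elim: s z => [|g s IH] z /=; first by move=> ->; exists [::]; rewrite big_ord0.
move=> [a [Ra /IH [c [sc Rc zc]]]]; exists (a :: c); split=> /=; first by rewrite sc.
  by move=> r [<-|/Rc].
by rewrite big_ord_recl /= -[RHS]/(a * g + \sum_(i < size s) c`_i * s`_i) -zc addrC subrK.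
Qed.

Lemma noetherian_noeth R : is_noetherian R -> noeth R.
Proof.
move=> [subR nR] J idJ; have [s [Rs Js]] := nR J idJ; exists s; split.
  by move=> g gs; apply/Js/rspan_ideal_gen/rspan_mem.
by move=> z /Js /ideal_gen_span; apply.
Qed.

Section Nakayama.
Variables (R : K -> Prop) (u : K).
Hypotheses (subR : is_subring R) (nR : noeth R) (Ru : R u).
Hypothesis jac : forall c, R c -> unit_in R (1 - u * c).

(** Nakayama's lemma for [J] modulo [hR], with [u] in the Jacobson radical. The element [h] need not
    lie in [J]: the case [h = 0] says that [J] vanishes as soon as it is contained in [uJ]. *)
Lemma nakayama J h : is_ideal R J -> R h ->
  (forall z, J z -> exists a j, [/\ R a, J j & z = h * a + u * j]) ->
  forall z, J z -> rdvd R h z.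
Proof.
move=> idJ Rh Jh; have [s [Js sJ]] := nR idJ.
(* The inclusion of [J] in [hR] plus the span of [s] is the invariant that survives the removal of a
   generator from [s]. *)
have {sJ} : forall z, J z -> exists c, R c /\ rspan R s (z - c * h).
  by move=> z /sJ sz; exists 0; rewrite mul0r subr0; split=> //; mem subR.
elim: s Js => [|g s IH] Js sJ.
  by move=> z /sJ [c [Rc /= /eqP]]; rewrite subr_eq0 => /eqP ->; exists c; rewrite 1?mulrC.
apply: IH; first by move=> k ks; apply: Js; rewrite inE ks orbT.
have [a [j [Ra Jj gE]]] := Jh g (Js g (mem_head _ _)).
have [c [Rc /= [b [Rb sj]]]] := sJ j Jj.
have [Re e0 Rei] := jac Rb.
have gs : rspan R s (g - (1 - u * b)^-1 * (a + u * c) * h).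
  have -> : g - (1 - u * b)^-1 * (a + u * c) * h = (1 - u * b)^-1 * u * (j - c * h - b * g).
    have eg : (1 - u * b) * g = h * (a + u * c) + u * (j - c * h - b * g).
      by rewrite mulrBl mul1r {1}gE; ring.
    by rewrite -{1}(mulKf e0 g) eg; ring.
  by apply: rspanZ => //; mem subR.
move=> z Jz; have [c' [Rc' /= [b' [Rb' sz]]]] := sJ z Jz.
exists (c' + b' * ((1 - u * b)^-1 * (a + u * c))); split; first by mem subR.
have -> : z - (c' + b' * ((1 - u * b)^-1 * (a + u * c))) * h =
   (z - c' * h - b' * g) + b' * (g - (1 - u * b)^-1 * (a + u * c) * h) by ring.
by apply: rspanD => //; apply: rspanZ.
Qed.

End Nakayama.

End Ideals.

(** * Divisibility and local rings with two parameters *)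

Lemma least_nat (P : nat -> Prop) :
  (exists n, P n) -> exists n, P n /\ forall m, P m -> (n <= m)%N.
Proof.
move=> [n Pn]; elim/ltn_ind: n Pn => n IH Pn.
have [[m [Pm lt_mn]]|no] := classic (exists m, P m /\ (m < n)%N); first exact: IH Pm.
by exists n; split=> // m Pm; rewrite leqNgt; apply/negP => lt_mn; apply: no; exists m.
Qed.

Section Divisibility.
Variables (K : fieldType) (R : K -> Prop) (subR : is_subring R).

Lemma rdvdD a b c : rdvd R a b -> rdvd R a c -> rdvd R a (b + c).
Proof. by move=> [d Rd ->] [e Re ->]; exists (d + e); [mem subR | rewrite mulrDr]. Qed.

Lemma rdvdMr a b c : R c -> rdvd R a b -> rdvd R a (b * c).
Proof. by move=> Rc [d Rd ->]; exists (d * c); [mem subR | rewrite mulrA]. Qed.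

Lemma rdvdMl a b c : R c -> rdvd R a b -> rdvd R a (c * b).
Proof. by rewrite mulrC; apply: rdvdMr. Qed.

Lemma rdvdN a b : rdvd R a b -> rdvd R a (- b).
Proof. by rewrite -mulrN1; apply: rdvdMr; mem subR. Qed.

Lemma rdvdB a b c : rdvd R a b -> rdvd R a c -> rdvd R a (b - c).
Proof. by move=> ab /rdvdN; apply: rdvdD. Qed.

Lemma rdvdrr a : rdvd R a a.
Proof. by exists 1; [mem subR | rewrite mulr1]. Qed.

Lemma rdvd_mulr a c : R c -> rdvd R a (a * c).
Proof. by move=> Rc; exists c. Qed.

Lemma rdvdr0 a : rdvd R a 0.
Proof. by exists 0; [mem subR | rewrite mulr0]. Qed.

Lemma unit_in1 : unit_in R 1.
Proof. by split; rewrite ?invr1 ?oner_neq0 //; mem subR. Qed.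

Lemma unit_inM a b : unit_in R a -> unit_in R b -> unit_in R (a * b).
Proof.
by move=> [Ra a0 Ra'] [Rb b0 Rb']; split; rewrite ?invfM ?mulf_neq0 //; mem subR.
Qed.

Lemma unit_inV a : unit_in R a -> unit_in R a^-1.
Proof. by move=> [Ra a0 Ra']; split; rewrite ?invrK ?invr_eq0. Qed.

Lemma rdvd_unitl a e b : unit_in R e -> rdvd R a (e * b) -> rdvd R a b.
Proof. by move=> [Re e0 Re'] /(rdvdMl Re'); rewrite mulKf. Qed.

Lemma rdvd_unitr a e b : unit_in R e -> rdvd R a (b * e) -> rdvd R a b.
Proof. by rewrite mulrC; apply: rdvd_unitl. Qed.

Lemma unit_dvd1 e : e != 0 -> R e -> rdvd R e 1 -> unit_in R e.
Proof.
move=> e0 Re [c Rc ec]; split=> //.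
by rewrite -[e^-1]mulr1 ec mulKf.
Qed.

Lemma prime_eltX p a n : prime_elt R p -> R a -> rdvd R p (a ^+ n) -> rdvd R p a.
Proof.
move=> [Rp p0 np pr] Ra; elim: n => [|n IH]; first by rewrite expr0.
by rewrite exprS => /pr [|||/IH] //; mem subR.
Qed.

End Divisibility.

Section LocalPair.
Variables (K : fieldType) (R : K -> Prop) (u w : K).

Lemma combD z z' : is_subring R -> comb R u w z -> comb R u w z' -> comb R u w (z + z').
Proof.
move=> subR [a [b [Ra Rb ->]]] [c [d [Rc Rd ->]]]; exists (a + c), (b + d); split; try by mem subR.
by ring.
Qed.

Lemma combM c z : is_subring R -> R c -> comb R u w z -> comb R u w (c * z).
Proof.
move=> subR Rc [a [b [Ra Rb ->]]]; exists (c * a), (c * b); split; try by mem subR.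
by ring.
Qed.

Lemma combB z z' : is_subring R -> comb R u w z -> comb R u w z' -> comb R u w (z - z').
Proof.
move=> subR cz cz'; apply: combD => //; rewrite -mulN1r; apply: combM => //.
by mem subR.
Qed.

Lemma rdvd_comb z : is_subring R -> rdvd R u z -> comb R u w z.
Proof.
move=> subR [c Rc ->]; exists c, 0; split=> //; first by mem subR.
by rewrite mul0r addr0 mulrC.
Qed.

Hypothesis loc : local2 R u w.

Let subR : is_subring R. Proof. by case: loc. Qed.
Let Ru : R u. Proof. by case: loc => _ []. Qed.
Let Rw : R w. Proof. by case: loc => _ []. Qed.

Lemma comb_mem z : comb R u w z -> R z.
Proof. by move=> [a [b [Ra Rb ->]]]; mem subR. Qed.

Lemma unit_not_comb e : unit_in R e -> ~ comb R u w e.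
Proof.
by case: loc => _ _ n1 _ [Re e0 Re'] /(combM subR Re'); rewrite mulVf.
Qed.

Lemma unit_add_comb e m : unit_in R e -> comb R u w m -> unit_in R (e + m).
Proof.
move=> Ue cm; have [Re _ _] := Ue; have Rm := comb_mem cm.
case: loc => _ _ _ /(_ (e + m)) [|//|cem]; first by mem subR.
by case: (unit_not_comb Ue); rewrite -(addrK m e); apply: combB.
Qed.

Lemma local_jac z c : comb R u w z -> R c -> unit_in R (1 - z * c).
Proof.
move=> cz Rc; apply: unit_add_comb; first exact: unit_in1.
by rewrite -mulNr mulrC mulrN -mulNr; apply: combM => //; mem subR.
Qed.

(** In [R/uR] every nonzero element is a unit times a power of [w], as in a discrete valuation ring.
    Powers of [w] are still allowed to vanish there. *)
Definition adic := forall r, R r -> rdvd R u r \/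
  exists e j c, [/\ unit_in R e, R c & r = e * w ^+ j + u * c].

(** As long as the coefficient of [w ^+ n] is not a unit it lies in [(u, w)], and its [w] part
    raises the exponent by one. *)
Lemma adic_approx n r : R r ->
  (exists c d, [/\ R c, R d & r = c * w ^+ n + u * d]) \/
  (exists e j c, [/\ unit_in R e, R c & r = e * w ^+ j + u * c]).
Proof.
move=> Rr; elim: n => [|n [[c [d [Rc Rd rE]]]|]]; last by right.
  by left; exists r, 0; rewrite expr0 mulr1 mulr0 addr0; split=> //; mem subR.
case: (loc) => _ _ _ /(_ c Rc) [Uc|[a [b [Ra Rb cE]]]]; first by right; exists c, n, d.
left; exists b, (a * w ^+ n + d); split; try by mem subR.
by rewrite rE cE exprS; ring.
Qed.

(** The approximation stops at exponent [n]. This serves the situation that [dim2_not_nilpotent]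
    refutes. *)
Lemma adic_nilpotent n : rdvd R u (w ^+ n) -> adic.
Proof.
move=> [a Ra wE] r Rr; have [[c [d [Rc Rd rE]]]|] := adic_approx n Rr; last by right.
by left; exists (c * a + d); [mem subR | rewrite rE wE; ring].
Qed.

Hypothesis nR : noeth R.

Lemma comb_l : comb R u w u. Proof. by apply: rdvd_comb => //; apply: rdvdrr. Qed.
Lemma comb_r : comb R u w w.
Proof. by exists 0, 1; split; rewrite ?mul0r ?mul1r ?add0r //; mem subR. Qed.

(* Krull's intersection theorem in R/uR: the ideal of elements lying in (u, w^n) for all n is uR. *)
Lemma adic_regular : (forall c, R c -> rdvd R u (w * c) -> rdvd R u c) -> adic.
Proof.
move=> nzd r Rr; have [|no] := classic (exists e j c, [/\ unit_in R e, R c & r = e * w ^+ j + u * c]).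
  by right.
left; pose J z := R z /\ forall n, exists c d, [/\ R c, R d & z = c * w ^+ n + u * d].
apply: (@nakayama _ R w subR nR Rw _ J) => //.
- by move=> c Rc; apply: local_jac => //; apply: comb_r.
- split.
  + by move=> z [].
  + split; first by mem subR.
    by move=> n; exists 0, 0; split; try mem subR; ring.
  + move=> a b [Ra Ja] [Rb Jb]; split; first by mem subR.
    move=> n; have [c [d [Rc Rd aE]]] := Ja n; have [c' [d' [Rc' Rd' bE]]] := Jb n.
    exists (c + c'), (d + d'); split; try by mem subR.
    by rewrite aE bE; ring.
  + move=> s a Rs [Ra Ja]; split; first by mem subR.
    move=> n; have [c [d [Rc Rd aE]]] := Ja n.
    exists (s * c), (s * d); split; try by mem subR.
    by rewrite aE; ring.
- move=> z [Rz Jz]; have [c [d [Rc Rd]]] := Jz 1%N; rewrite expr1 => zE.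
  exists d, c; split=> //; last by rewrite zE; ring.
  (* Comparing the expressions of [z] at the exponents 1 and [n.+1] and cancelling [w] modulo [u]
     shows that the cofactor [c] of [w] is again in [J]. *)
  split=> // n; have [c' [d' [Rc' Rd' zE']]] := Jz n.+1.
  have [||e Re cE] := nzd (c - c' * w ^+ n); first by mem subR.
    exists (d' - d); first by mem subR.
    have : c * w + u * d = c' * w ^+ n.+1 + u * d' by rewrite -zE -zE'.
    rewrite exprS => eqn; apply: (addIr (u * d)).
    have -> : w * (c - c' * w ^+ n) + u * d = (c * w + u * d) - c' * (w * w ^+ n) by ring.
    by rewrite eqn; ring.
  by exists c', e; split=> //; rewrite -cE addrC subrK.
- by split=> // n; have [//|] := adic_approx n Rr.
Qed.

(** The image of [Q] in [R/uR] is generated by an element of least order in [w]. Let [h] be a lift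
    of it in [Q]. Since [Q] is saturated with respect to [u], it is contained in [hR + uQ], and
    Nakayama's lemma applies. *)
Lemma principal_ideal Q : adic -> is_ideal R Q ->
    (forall c, R c -> Q (u * c) -> Q c) -> (exists z, Q z /\ ~ rdvd R u z) ->
  exists h, Q h /\ forall z, Q z -> rdvd R h z.
Proof.
move=> ad idQ Qu [z0 [Qz0 nz0]]; have [QR Q0 QD QM] := idQ.
pose ord j z := exists e c, [/\ unit_in R e, R c & z = e * w ^+ j + u * c].
have [|j [[h [Qh [e [c [Ue Rc hE]]]]] minj]] := @least_nat (fun j => exists z, Q z /\ ord j z).
  by have [//|[e [j [c [Ue Rc zE]]]]] := ad z0 (QR _ Qz0); exists j, z0; split=> //; exists e, c.
exists h; split=> //; apply: (nakayama subR nR Ru _ idQ).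
- by move=> d Rd; apply: local_jac Rd; apply: comb_l.
- exact: QR.
move=> z Qz; have [[d Rd zE]|[e' [j' [c' [Ue' Rc' zE]]]]] := ad z (QR _ Qz).
  exists 0, d; split; [by mem subR | | by rewrite zE; ring].
  by apply: Qu => //; rewrite -zE.
have le : (j <= j')%N by apply: minj; exists z; split=> //; exists e', c'.
have [Re e0 Rei] := Ue; have [Re' _ _] := Ue'.
(* This multiplier gives [b * h] the same leading term as [z]; their difference is then [u] times an
   element of [Q]. *)
pose b := e' * e^-1 * w ^+ (j' - j).
have Rb : R b by rewrite /b; mem subR.
have bh : b * h = e' * w ^+ j' + u * (b * c).
  have be : b * e = e' * w ^+ (j' - j) by rewrite /b; field.
  by rewrite hE mulrDr mulrA be -mulrA -exprD subnK //; congr (_ + _); ring.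
exists b, (c' - b * c); split=> //.
  apply: Qu; first by mem subR.
  have -> : u * (c' - b * c) = z + (- b) * h by rewrite mulNr bh zE; ring.
  by apply: QD => //; apply: QM => //; mem subR.
by rewrite [h * b]mulrC bh zE; ring.
Qed.

End LocalPair.

(** * Dimension two and factoriality *)

Section DimensionTwo.
Variables (K : fieldType) (R P : K -> Prop).
Hypotheses (nR : noeth R) (prP : is_prime_ideal R P).
Hypothesis nzP : exists z, P z /\ z != 0.

(* This special case of Krull's principal ideal theorem is where the dimension enters: if w^n were
   in uR, then P would be principal, generated by h say, and a power of h would be in uR. *)
Lemma dim2_not_nilpotent u w n : local2 R u w -> ~ (P u /\ P w) -> ~ rdvd R u (w ^+ n).
Proof.
move=> loc nm uw; have ad := adic_nilpotent loc uw; have [subR [Ru Rw] n1 _] := loc.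
have [idP P1 PM] := prP; have [PR P0 PD PZ] := idP.
have nPu : ~ P u.
  move=> Pu; apply: nm; split=> //.
  have : P (w ^+ n) by case: uw => c Rc ->; rewrite mulrC; apply: PZ.
  by elim: n {uw} => [|m IH]; rewrite ?expr0 // exprS => /PM [||//|/IH//]; mem subR.
have Pu c : R c -> P (u * c) -> P c by move=> Rc /PM [].
have jac c : R c -> unit_in R (1 - u * c) by apply: (local_jac loc); apply: (comb_l loc).
have [|h [Ph hP]] := principal_ideal loc nR ad idP Pu.
  (* If [P] were contained in [uR], then [P = uP] because [u] is not in [P], and Nakayama's lemma
     with [h = 0] would give [P = 0]. *)
  apply: NNPP => no; have [z [Pz /eqP]] := nzP; apply.
  suff [c _ ->] : rdvd R 0 z by rewrite mul0r.
  apply: (nakayama subR nR Ru jac idP) => //; first by mem subR.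
  move=> {Pz} {}z Pz; have [c Rc zE] : rdvd R u z.
    by apply: NNPP => nz; apply: no; exists z.
  exists 0, c; split; [by mem subR | by apply: Pu; rewrite -?zE | by rewrite zE; ring].
have h0 : h != 0.
  apply/eqP => h0; have [z [/hP [c _ ->] /eqP]] := nzP; apply.
  by rewrite h0 mul0r.
(* As a nonunit, [h] is congruent to [b w] modulo [u], so [h ^+ n] is a multiple of [w ^+ n] modulo
   [u], hence lies in [uR]. *)
have [a [b [Ra Rb hE]]] : comb R u w h.
  case: loc => _ _ _ /(_ h (PR _ Ph)) [[_ _ Rh]|//]; case: P1.
  by rewrite -(mulVf h0); apply: PZ.
have hX m : exists c d, [/\ R c, R d & h ^+ m = c * w ^+ m + u * d].
  elim: m => [|m [c [d [Rc Rd IH]]]].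
    by exists 1, 0; rewrite !expr0; split; try mem subR; ring.
  have Rh := PR _ Ph.
  exists (b * c), (a * (c * w ^+ m) + h * d); split; try by mem subR.
  by rewrite exprS IH mulrDr {1}hE exprS; ring.
have [c [d [Rc Rd hn]]] := hX n; have [e Re wE] := uw.
have {hn} : exists2 f, R f & h ^+ n = u * f.
  by exists (c * e + d); [mem subR | rewrite hn wE; ring].
(* Descent on the exponent: if [h ^+ m.+1 = u f], then [f] is in [P], hence divisible by [h], and
   one factor [h] cancels. At exponent 0 the element [u] would divide 1. *)
elim: (n) => [|m IH] [f Rf].
  rewrite expr0 => uf; apply: n1; rewrite uf; apply: rdvd_comb => //.
  exact: rdvd_mulr.
rewrite exprS => hE'; have /hP [f' Rf' fE] : P f.
  by apply: Pu => //; rewrite -hE' mulrC; apply: PZ => //; apply: subringX => //; apply: PR.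
by apply: IH; exists f' => //; apply: (mulfI h0); rewrite hE' fE; ring.
Qed.

(** First [w] is shown to be a nonzerodivisor modulo [u], which gives [adic]. Elements of orders [j]
    and [j'] then have a product of order [j + j'], and no power of [w] vanishes modulo [u]. *)
Lemma dim2_prime u w : local2 R u w -> ~ (P u /\ P w) -> prime_elt R u.
Proof.
move=> loc nm; have [subR [Ru Rw] n1 locR] := loc.
have nuw n := @dim2_not_nilpotent u w n loc nm.
have nzd c : R c -> rdvd R u (w * c) -> rdvd R u c.
  (* [Q] consists of the elements killed modulo [u] by a power of [w]. It contains no unit, so it is
     contained in [uR + wQ], and Nakayama's lemma puts it inside [uR]. *)
  move=> Rc uwc; pose Q z := R z /\ exists n, rdvd R u (w ^+ n * z).
  apply: (@nakayama _ R w subR nR Rw _ Q) => //.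
  - by move=> d Rd; apply: (local_jac loc _ Rd); apply: (comb_r loc).
  - split.
    + by move=> z [].
    + by split; [mem subR | exists 0%N; rewrite mulr0; apply: rdvdr0].
    + move=> a b [Ra [n ua]] [Rb [m ub]]; split; first by mem subR.
      exists (n + m)%N; rewrite exprD mulrDr; apply: rdvdD => //.
        rewrite [_ ^+ n * _]mulrC -mulrA; apply: rdvdMl => //; mem subR.
      by rewrite -mulrA; apply: rdvdMl => //; mem subR.
    + move=> r a Rr [Ra [n ua]]; split; first by mem subR.
      by exists n; rewrite mulrCA; apply: rdvdMl.
  - move=> z [Rz [n uz]]; have [Uz|[a [b [Ra Rb zE]]]] := locR z Rz.
      by case: (nuw n); apply: (rdvd_unitr subR Uz).
    exists a, b; split=> //; last by rewrite zE; ring.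
    split=> //; exists n.+1; have -> : w ^+ n.+1 * b = w ^+ n * z - u * (w ^+ n * a).
      by rewrite zE exprS; ring.
    by apply: rdvdB => //; apply: rdvd_mulr; mem subR.
  - by split=> //; exists 1%N; rewrite expr1.
have ad := adic_regular loc nR nzd; split=> //.
(* The roles of [u] and [w] are exchanged here: [u = 0] would be a first power divisible by [w]. *)
- apply/eqP => u0; apply: (@dim2_not_nilpotent w u 1 (local2C loc)).
    by move=> [Pw Pu]; apply: nm.
  by rewrite u0 expr1; apply: rdvdr0.
- by move=> u1; apply: (nuw 0%N); rewrite expr0.
move=> a b Ra Rb uab; have [|[e [j [c [Ue Rc aE]]]]] := ad a Ra; first by left.
have [|[e' [j' [c' [Ue' Rc' bE]]]]] := ad b Rb; first by right.
case: (nuw (j + j')%N); apply: (rdvd_unitl subR (unit_inM subR Ue Ue')).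
have [Re _ _] := Ue; have [Re' _ _] := Ue'.
have -> : e * e' * w ^+ (j + j') =
    a * b - u * (c * (e' * w ^+ j' + u * c') + e * w ^+ j * c').
  by rewrite aE bE exprD; ring.
by apply: rdvdB => //; apply: rdvd_mulr; mem subR.
Qed.

End DimensionTwo.

(** * Factoriality of a regular local ring of dimension two *)

Section Factorial.
Variables (K : fieldType).
Implicit Types (R : K -> Prop).

(** The factors are prime elements, not merely irreducible ones, which makes the factorization
    essentially unique. *)
Definition factors R r := exists e (s : seq K),
  [/\ unit_in R e, (forall h, h \in s -> prime_elt R h) & r = e * \prod_(h <- s) h].

Definition ufd R := forall r, R r -> r != 0 -> factors R r.

Lemma factorsM R r r' : is_subring R -> factors R r -> factors R r' -> factors R (r * r').
Proof.
move=> subR [e [s [Ue sp ->]]] [e' [s' [Ue' sp' ->]]]; exists (e * e'), (s ++ s'); split.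
- exact: unit_inM.
- by move=> h; rewrite mem_cat => /orP [/sp|/sp'].
by rewrite big_cat /=; ring.
Qed.

Lemma factors_prime R r : is_subring R -> prime_elt R r -> factors R r.
Proof.
move=> subR pr; exists 1, [:: r]; split; first exact: unit_in1.
  by move=> h; rewrite inE => /eqP ->.
by rewrite big_seq1 mul1r.
Qed.

Section Regular.
Variables (R : K -> Prop) (u w : K).
Hypotheses (loc : local2 R u w) (nR : noeth R) (pu : prime_elt R u) (nuw : ~ rdvd R u w).

Let subR : is_subring R. Proof. by case: loc. Qed.
Let Ru : R u. Proof. by case: loc => _ []. Qed.
Let Rw : R w. Proof. by case: loc => _ []. Qed.

Let ad : adic R u w.
Proof.
apply: adic_regular => // c Rc; have [_ _ _ pr] := pu.
by move=> /pr [].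
Qed.

Let nuwX n : ~ rdvd R u (w ^+ n).
Proof. by move/(prime_eltX subR pu Rw). Qed.

(** If the extraction of factors [u] never stopped, [r] would lie in the intersection [J] of the
    ideals generated by the powers of [u]. Cancelling [u] shows that [J] is contained in [uJ], so
    [J = 0]. *)
Lemma regular_split_l r : R r -> r != 0 -> exists n r', [/\ R r', ~ rdvd R u r' & r = u ^+ n * r'].
Proof.
move=> Rr /eqP r0; apply: NNPP => no; apply: r0.
pose J z := R z /\ forall n, rdvd R (u ^+ n) z.
have [_ u0 _ _] := pu.
suff [c _ ->] : rdvd R 0 r by rewrite mul0r.
apply: (@nakayama _ R u subR nR Ru _ J).
- by move=> d Rd; apply: (local_jac loc _ Rd); apply: (comb_l loc).
- split.
  + by move=> z [].
  + by split; [mem subR | move=> n; apply: rdvdr0].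
  + by move=> a b [Ra ua] [Rb ub]; split; [mem subR | move=> n; apply: rdvdD].
  + by move=> s a Rs [Ra ua]; split; [mem subR | move=> n; apply: rdvdMl].
- by mem subR.
- move=> z [Rz uz]; have [c Rc zE] := uz 1%N; rewrite expr1 in zE.
  exists 0, c; split; [by mem subR | | by rewrite zE; ring].
  split=> // n; have [d Rd zE'] := uz n.+1; exists d => //.
  by apply: (mulfI u0); rewrite -zE zE' exprS; ring.
split=> // n; elim: n => [|n [c Rc rE]]; first by exists r; rewrite ?expr0 ?mul1r.
have [d Rd cE] : rdvd R u c by apply: NNPP => nc; apply: no; exists n, c.
by exists d => //; rewrite rE cE exprS; ring.
Qed.

(* For r not divisible by u, the ideal (r : a) satisfies the hypotheses of [principal_ideal]. *)
Lemma irreducible_prime r : R r -> ~ rdvd R u r -> ~ unit_in R r ->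
  (forall a b, R a -> R b -> r = a * b -> unit_in R a \/ unit_in R b) -> prime_elt R r.
Proof.
move=> Rr nur nU irr; have [_ u0 _ pr] := pu.
have r0 : r != 0 by apply/eqP => r0; apply: nur; rewrite r0; apply: rdvdr0.
split=> //; first by move/(unit_dvd1 r0 Rr).
move=> a b Ra Rb rab; pose Q z := R z /\ rdvd R r (a * z).
have idQ : is_ideal R Q.
  split.
  - by move=> z [].
  - by split; [mem subR | rewrite mulr0; apply: rdvdr0].
  - by move=> z z' [Rz dz] [Rz' dz']; split; [mem subR | rewrite mulrDr; apply: rdvdD].
  - by move=> s z Rs [Rz dz]; split; [mem subR | rewrite mulrCA; apply: rdvdMl].
have [||h [[Rh [c Rc ahE]] hQ]] := principal_ideal loc nR ad idQ.
- move=> c Rc [_ [d Rd dE]]; split=> //.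
  have : rdvd R u (r * d) by rewrite -dE mulrCA; apply: rdvd_mulr; mem subR.
  move=> /pr [] // [d' Rd' dE'].
  by exists d' => //; apply: (mulfI u0); rewrite mulrCA dE dE'; ring.
- by exists r; split=> //; split=> //; apply: rdvdMl => //; apply: rdvdrr.
have [|d Rd rE] := hQ r; first by split=> //; apply: rdvdMl => //; apply: rdvdrr.
(* Here [h] generates [(r : a)] and [r = h d]. Either [h] is a unit and [r] divides [a], or [d] is a
   unit and [(r : a) = rR] contains [b]. *)
have [[_ h0 Rh']|[_ d0 Rd']] := irr h d Rh Rd rE.
  by left; exists (c * h^-1); [mem subR | rewrite mulrA -ahE mulfK].
right; have [|f Rf ->] := hQ b; first by split.
by exists (d^-1 * f); [mem subR | rewrite rE; field].
Qed.

(** Induction on a bound for [j], the order of [r] modulo [u]. A nonunit factor of [r] has positive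
    order, so both factors of a proper factorization have smaller order. *)
Lemma regular_factors n r e j c : (j <= n)%N -> unit_in R e -> R c ->
  r = e * w ^+ j + u * c -> factors R r.
Proof.
elim: n r e j c => [|n IH] r e j c.
  rewrite leqn0 => /eqP -> Ue Rc ->; rewrite expr0 mulr1.
  exists (e + u * c), [::]; rewrite big_nil mulr1; split=> //.
  by apply: (unit_add_comb loc) => //; apply: rdvd_comb => //; apply: rdvd_mulr.
move=> le_jn Ue Rc rE; have [Re e0 Re'] := Ue.
have Rr : R r by rewrite rE; mem subR.
have nur : ~ rdvd R u r.
  move=> ur; apply: (@nuwX j); apply: (rdvd_unitl subR Ue).
  rewrite -(addrK (u * c) (e * _)) -rE; apply: rdvdB => //; exact: rdvd_mulr.
have [Ur|nU] := classic (unit_in R r).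
  by exists r, [::]; rewrite big_nil mulr1; split.
have [[a [b [Ra Rb rab nUa nUb]]]|irr] := classic (exists a b,
    [/\ R a, R b, r = a * b, ~ unit_in R a & ~ unit_in R b]); last first.
  apply: factors_prime => //; apply: irreducible_prime => // a b Ra Rb rab.
  by apply: NNPP => no; apply: irr; exists a, b; split=> // U; apply: no; [left | right].
have ord a' : R a' -> ~ unit_in R a' -> rdvd R a' r ->
    exists e' j' c', [/\ unit_in R e', R c', a' = e' * w ^+ j' + u * c' & (0 < j')%N].
  move=> Ra' nUa' [d Rd rd]; have [ua'|[e' [j' [c' [Ue' Rc' aE]]]]] := ad Ra'.
    by case: nur; rewrite rd; apply: rdvdMr.
  exists e', j', c'; split=> //; rewrite lt0n; apply/eqP => j0; apply: nUa'.
  rewrite aE j0 expr0 mulr1; apply: (unit_add_comb loc) => //.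
  by apply: rdvd_comb => //; apply: rdvd_mulr.
have [|e1 [j1 [c1 [Ue1 Rc1 aE j1_gt0]]]] := ord a Ra nUa; first by rewrite rab; apply: rdvd_mulr.
have [|e2 [j2 [c2 [Ue2 Rc2 bE j2_gt0]]]] := ord b Rb nUb.
  by rewrite rab mulrC; apply: rdvd_mulr.
(* Otherwise the two expressions of [r] modulo [u] differ by [w ^+ j] times [e] minus a multiple of
   [w]. That coefficient is a unit, so [u] would divide [w ^+ j]. *)
have le : (j1 + j2 <= j)%N.
  rewrite leqNgt; apply/negP => lt_j; apply: (@nuwX j).
  have [Re1 _ _] := Ue1; have [Re2 _ _] := Ue2.
  pose m := (j1 + j2 - j.+1)%N; have jE : (j1 + j2 = j + m.+1)%N by rewrite /m; lia.
  have Umm : unit_in R (e - w * (e1 * e2 * w ^+ m)).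
    apply: (unit_add_comb loc) => //; rewrite -mulNr mulrC mulrN -mulNr.
    by apply: combM => //; [mem subR | apply: (comb_r loc)].
  apply: (rdvd_unitl subR Umm).
  have -> : (e - w * (e1 * e2 * w ^+ m)) * w ^+ j =
     u * (c1 * (e2 * w ^+ j2 + u * c2) + e1 * w ^+ j1 * c2 - c).
    have : e * w ^+ j + u * c = (e1 * w ^+ j1 + u * c1) * (e2 * w ^+ j2 + u * c2).
      by rewrite -rE rab aE bE.
    have jX : w ^+ j1 * w ^+ j2 = w ^+ j * (w * w ^+ m) by rewrite -exprS -!exprD jE.
    move=> eqn; have -> : (e - w * (e1 * e2 * w ^+ m)) * w ^+ j =
       e * w ^+ j + u * c - u * c - e1 * e2 * (w ^+ j * (w * w ^+ m)) by ring.
    by rewrite eqn -jX; ring.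
  by apply: rdvd_mulr => //; mem subR.
rewrite rab; apply: factorsM => //; [apply: (IH a e1 j1 c1) | apply: (IH b e2 j2 c2)] => //; lia.
Qed.

Lemma regular_ufd : ufd R.
Proof.
move=> r Rr r0; have [n [r' [Rr' nur' ->]]] := regular_split_l Rr r0.
apply: factorsM => //.
  elim: n => [|n IH]; last by rewrite exprS; apply: factorsM => //; apply: factors_prime.
  by exists 1, [::]; rewrite big_nil mulr1; split=> //; apply: unit_in1.
have [//|[e [j [c [Ue Rc rE]]]]] := ad Rr'.
exact: regular_factors (leqnn j) Ue Rc rE.
Qed.

End Regular.
End Factorial.

(** * Simple ring extensions and Hilbert's basis theorem *)

Section Polynomials.
Variables (K : fieldType).
Implicit Types (R I J : K -> Prop) (f g h : {poly K}) (t : K).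

Definition polyin R f := forall i, R f`_i.

Section Polyin.
Variables (R : K -> Prop) (subR : is_subring R).

Lemma polyin0 : polyin R 0.
Proof. by move=> i; rewrite coef0; mem subR. Qed.
Lemma polyinC c : R c -> polyin R c%:P.
Proof. by move=> Rc i; rewrite coefC; case: eqP => _ //; mem subR. Qed.
Lemma polyinX : polyin R 'X.
Proof. by move=> i; rewrite coefX; case: eqP => _; mem subR. Qed.
Lemma polyinD f g : polyin R f -> polyin R g -> polyin R (f + g).
Proof. by move=> Rf Rg i; rewrite coefD; apply: subringD. Qed.
Lemma polyinN f : polyin R f -> polyin R (- f).
Proof. by move=> Rf i; rewrite coefN; apply: subringN. Qed.
Lemma polyinM f g : polyin R f -> polyin R g -> polyin R (f * g).
Proof. by move=> Rf Rg i; rewrite coefM; apply: subring_sum => // j _; apply: subringM. Qed.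
Lemma polyinXn f n : polyin R f -> polyin R (f ^+ n).
Proof.
move=> Rf; elim: n => [|n IH]; first by rewrite expr0; apply: polyinC; mem subR.
by rewrite exprS; apply: polyinM.
Qed.

End Polyin.

End Polynomials.

Ltac pmem subR := repeat first [assumption | apply: (polyinX subR) | apply: (polyin0 subR)
  | apply: (polyinD subR) | apply: (polyinN subR) | apply: (polyinM subR)
  | apply: (polyinXn subR) | apply: (polyinC subR) ]; mem subR.

Section Adjoin.
Variables (K : fieldType).
Implicit Types (R I J : K -> Prop) (f g h : {poly K}) (t : K).

Lemma polyin_ind R (Q : {poly K} -> Prop) : Q 0 ->
  (forall f c, polyin R f -> R c -> Q f -> Q (f * 'X + c%:P)) ->
  forall f, polyin R f -> Q f.
Proof.
move=> Q0 QS; elim/poly_ind => [|f c IH] Rf //.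
have Rf' : polyin R f.
  by move=> i; have := Rf i.+1; rewrite coefD coefMX coefC /= addr0.
apply: QS => //; last exact: IH.
by have := Rf 0%N; rewrite coefD coefMX coefC /= add0r.
Qed.

Lemma adjoin_intro R f t : polyin R f -> adjoin R t f.[t].
Proof. by move=> Rf; exists f. Qed.

Lemma adjoin_subring R t : is_subring R -> is_subring (adjoin R t).
Proof.
move=> subR; split.
- by exists 0; rewrite horner0; split=> //; apply: polyin0.
- by exists 1%:P; rewrite hornerC; split=> //; apply: polyinC => //; mem subR.
- move=> _ _ [f [Rf ->]] [g [Rg ->]]; exists (f - g); rewrite !hornerE; split=> //.
  by rewrite -/(polyin R _); pmem subR.
- move=> _ _ [f [Rf ->]] [g [Rg ->]]; exists (f * g); rewrite !hornerE; split=> //.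
  by rewrite -/(polyin R _); pmem subR.
Qed.

Lemma adjoin_base R t r : is_subring R -> R r -> adjoin R t r.
Proof. by move=> subR Rr; rewrite -(hornerC r t); apply: adjoin_intro; apply: polyinC. Qed.

Lemma adjoin_gen R t : is_subring R -> adjoin R t t.
Proof. by move=> subR; rewrite -{2}(hornerX t); apply: adjoin_intro; apply: polyinX. Qed.

Lemma adjoin_ind R t (Q : K -> Prop) : Q 0 ->
  (forall z r, adjoin R t z -> Q z -> R r -> Q (z * t + r)) ->
  forall z, adjoin R t z -> Q z.
Proof.
move=> Q0 QS _ [f [Rf ->]]; move: f Rf; apply: polyin_ind => [|f c Rf Rc IH].
  by rewrite horner0.
by rewrite hornerD hornerMX hornerC; apply: QS => //; apply: adjoin_intro.
Qed.

Lemma adjoin_least R t (Q : K -> Prop) : is_subring Q -> (forall r, R r -> Q r) -> Q t ->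
  forall z, adjoin R t z -> Q z.
Proof.
move=> subQ RQ Qt; apply: adjoin_ind; first by mem subQ.
by move=> z r _ Qz /RQ Qr; mem subQ.
Qed.

Lemma size_sub_lead f g n : (size f <= n.+1)%N -> (size g <= n.+1)%N -> f`_n = g`_n ->
  (size (f - g)%R <= n)%N.
Proof.
move=> sf sg fg; apply/leq_sizeP => j; rewrite leq_eqVlt => /predU1P [<-|lt_nj].
  by rewrite coefB fg subrr.
by rewrite coefB !nth_default ?subrr //; apply: leq_trans lt_nj.
Qed.

Section HilbertBasis.
Variables (R I : K -> Prop) (t : K).
Hypotheses (subR : is_subring R) (nR : noeth R) (idI : is_ideal (adjoin R t) I).

(** [J] is the preimage of [I] under evaluation at [t], and [L n] collects the coefficients of
    degree [n] of its members of degree at most [n]. Polynomials are needed because an element of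
    [adjoin R t] has no degree of its own. *)
Let J f := polyin R f /\ I f.[t].
Let L n c := exists f, [/\ J f, (size f <= n.+1)%N & f`_n = c].

Let J0 : J 0.
Proof. by case: idI => _ I0 _ _; split; [apply: polyin0 | rewrite horner0]. Qed.

Let JD f g : J f -> J g -> J (f + g).
Proof.
by case: idI => _ _ ID _ [Rf If] [Rg Ig]; split; [pmem subR | rewrite hornerD; apply: ID].
Qed.

Let JM f g : polyin R f -> J g -> J (f * g).
Proof.
case: idI => _ _ _ IM Rf [Rg Ig]; split; first by pmem subR.
by rewrite hornerM; apply: IM => //; apply: adjoin_intro.
Qed.

Let JB f g : J f -> J g -> J (f - g).
Proof. by move=> Jf Jg; apply: JD => //; rewrite -mulN1r; apply: JM => //; pmem subR. Qed.

Let idL n : is_ideal R (L n).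
Proof.
split.
- by move=> _ [f [[Rf _] _ <-]].
- by exists 0; split=> //; rewrite ?size_poly0 ?coef0.
- move=> _ _ [f [Jf sf <-]] [g [Jg sg <-]]; exists (f + g); split; [exact: JD| |by rewrite coefD].
  by apply: leq_trans (size_polyD _ _) _; rewrite geq_max sf sg.
- move=> r _ Rr [f [Jf sf <-]]; exists (r%:P * f); split; last by rewrite coefCM.
    by apply: JM => //; apply: polyinC.
  by rewrite mul_polyC; apply: leq_trans (size_scale_leq _ _) sf.
Qed.

Let L_le n m c : (n <= m)%N -> L n c -> L m c.
Proof.
move=> /subnK <-; elim: (m - n)%N => [|d IH] // /IH [f [Jf sf <-]].
exists ('X * f); split; first by apply: JM => //; apply: polyinX.
  have [->|f0] := eqVneq f 0; first by rewrite mulr0 size_poly0.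
  by rewrite mulrC size_mulX.
by rewrite coefXM addSn.
Qed.

Let idLoo : is_ideal R (fun c => exists n, L n c).
Proof.
split.
- by move=> c [n [f [[Rf _] _ <-]]].
- by exists 0%N; case: (idL 0).
- move=> a b [n La] [m Lb]; exists (maxn n m); case: (idL (maxn n m)) => _ _ LD _.
  by apply: LD; [apply: L_le La | apply: L_le Lb]; rewrite ?leq_maxl ?leq_maxr.
- by move=> r a Rr [n La]; exists n; case: (idL n) => _ _ _; apply.
Qed.

(** Generators of an ideal of leading coefficients are realized by polynomials of [J]; their values
    at [t] form the list [es], which works for every combination at once. *)
Let lift n (s : seq K) : (forall c, c \in s -> L n c) ->
  exists es : seq K, (forall e, e \in es -> I e) /\
  forall c, rspan R s c -> exists f, [/\ J f, (size f <= n.+1)%N, f`_n = c & rspan R es f.[t]].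
Proof.
elim: s => [|c0 s IH] Ls.
  exists [::]; split=> // c /= ->; exists 0.
  by rewrite size_poly0 coef0 horner0; split.
have [|es [Ies es_lift]] := IH; first by move=> c cs; apply: Ls; rewrite inE cs orbT.
have [f0 [Jf0 sf0 f0n]] := Ls c0 (mem_head _ _).
exists (f0.[t] :: es); split.
  by move=> e; rewrite inE => /predU1P [->|/Ies //]; case: Jf0.
move=> c /= [a [Ra /es_lift [f [Jf sf fn sp]]]]; exists (a%:P * f0 + f); split.
- by apply: JD => //; apply: JM => //; apply: polyinC.
- apply: leq_trans (size_polyD _ _) _; rewrite geq_max sf andbT mul_polyC.
  exact: leq_trans (size_scale_leq _ _) sf0.
- by rewrite coefD coefCM f0n fn addrC subrK.
by exists a; split=> //; rewrite hornerD hornerM hornerC addrC addKr.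
Qed.

(** The finitely many degrees below [n] are treated one by one, each with its own ideal [L n] of
    leading coefficients. *)
Let small n : exists es : seq K, (forall e, e \in es -> I e) /\
  forall f, J f -> (size f <= n)%N -> rspan R es f.[t].
Proof.
elim: n => [|n [es [Ies es_span]]].
  exists [::]; split=> // f _; rewrite size_poly_leq0 => /eqP ->.
  by rewrite horner0.
have [s [Ls sL]] := nR (idL n); have [es' [Ies' es'_lift]] := lift Ls.
exists (es' ++ es); split; first by move=> e; rewrite mem_cat => /orP [/Ies'|/Ies].
move=> f Jf sf; have [|f' [Jf' sf' f'n sp]] := es'_lift f`_n; first by apply: sL; exists f.
rewrite -(subrK f' f) hornerD addrC; apply: rspan_cat => //.
by apply: es_span; [exact: JB | apply: size_sub_lead].
Qed.

Lemma hilbert_basis : exists s : seq K, (forall c, c \in s -> I c) /\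
  (forall z, I z -> rspan (adjoin R t) s z).
Proof.
have subA := adjoin_subring t subR.
have [s [Ls sL]] := nR idLoo.
(* The finitely many generators of the union of the ideals [L n] all occur in a single degree [n];
   from there on the leading coefficients need no new generators. *)
have [n {}Ls] : exists n, forall c, c \in s -> L n c.
  elim: s Ls {sL} => [|c s IH] Ls; first by exists 0%N.
  have [|n Ln] := IH; first by move=> d ds; apply: Ls; rewrite inE ds orbT.
  have [m Lm] := Ls c (mem_head _ _); exists (maxn m n) => d.
  rewrite inE => /predU1P [->|/Ln Ld]; first exact: L_le (leq_maxl _ _) Lm.
  exact: L_le (leq_maxr _ _) Ld.
have [es1 [Ies1 es1_lift]] := lift Ls; have [es2 [Ies2 es2_span]] := small n.
have RA z s' : rspan R s' z -> rspan (adjoin R t) s' z.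
  by apply: rspan_mono => r; apply: adjoin_base.
have key m f : (size f <= m)%N -> J f -> rspan (adjoin R t) (es1 ++ es2) f.[t].
  elim: m f => [|m IH] f sf Jf.
    move: sf; rewrite size_poly_leq0 => /eqP ->; rewrite horner0; exact: rspan0.
  have [sfn|lt_nf] := leqP (size f) n.
    rewrite -(add0r f.[t]); apply: rspan_cat => //; [exact: rspan0 | exact/RA/es2_span].
  have le_nm : (n <= m)%N by rewrite -ltnS; apply: leq_trans lt_nf sf.
  have [|f' [Jf' sf' f'n sp]] := es1_lift f`_m; first by apply: sL; exists m, f.
  (* The shift by ['X^(m - n)] aligns the leading term of [f'], of degree at most [n], with that of
     [f] in degree [m]. *)
  rewrite -(subrK ('X^(m - n) * f') f) hornerD; apply: rspanD => //.
    apply: IH; last by apply: JB => //; apply: JM => //; pmem subR.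
    apply: size_sub_lead => //; last by rewrite coefXnM ltnNge leq_subr /= subKn.
    apply: leq_trans (size_polyMleq _ _) _; rewrite size_polyXn /=.
    by move: sf' le_nm; move: (size f'); lia.
  rewrite hornerM hornerXn; apply: rspanZ => //.
    by apply: subringX => //; apply: adjoin_gen.
  by rewrite -[f'.[t]]addr0; apply: rspan_cat; [exact: RA | exact: rspan0].
exists (es1 ++ es2); split; first by move=> e; rewrite mem_cat => /orP [/Ies1|/Ies2].
move=> z Iz; case: idI => /(_ z Iz) [f [Rf zE]] _ _ _.
by rewrite zE; apply: (key (size f)) => //; split=> //; rewrite -zE.
Qed.

End HilbertBasis.

Lemma noeth_adjoin R t : is_subring R -> noeth R -> noeth (adjoin R t).
Proof. by move=> subR nR I idI; apply: hilbert_basis. Qed.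

End Adjoin.

(** * Quadratic transforms *)

Section Localize.
Variables (K : fieldType) (R I : K -> Prop).
Hypotheses (subR : is_subring R) (prI : is_prime_ideal R I).

Let I0 : I 0. Proof. by case: prI => [[]]. Qed.
Let neq0 s : ~ I s -> s != 0. Proof. by move=> Is; apply/eqP => s0; apply: Is; rewrite s0. Qed.
Let notIM s s' : R s -> R s' -> ~ I s -> ~ I s' -> ~ I (s * s').
Proof. by case: prI => _ _ pr Rs Rs' Is Is' /pr []. Qed.

Lemma localize_base r : R r -> localize R I r.
Proof. by case: prI => _ I1 _ Rr; exists r, 1; rewrite divr1; split=> //; mem subR. Qed.

Lemma localizeV s : R s -> ~ I s -> localize R I s^-1.
Proof. by move=> Rs Is; exists 1, s; rewrite div1r; split=> //; mem subR. Qed.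

Lemma localize_subring : is_subring (localize R I).
Proof.
split; try by apply: localize_base; mem subR.
- move=> _ _ [r [s [Rr Rs Is ->]]] [r' [s' [Rr' Rs' Is' ->]]].
  exists (r * s' - r' * s), (s * s'); split; try by mem subR.
    exact: notIM.
  by field; rewrite !neq0.
- move=> _ _ [r [s [Rr Rs Is ->]]] [r' [s' [Rr' Rs' Is' ->]]].
  exists (r * r'), (s * s'); split; try by mem subR.
    exact: notIM.
  by field; rewrite !neq0.
Qed.

Lemma noeth_localize : noeth R -> noeth (localize R I).
Proof.
move=> nR J [JL J0 JD JM]; have subL := localize_subring.
have [|s [Js sJ]] := nR (fun z => R z /\ J z).
  split=> [z []//||a b [Ra Ja] [Rb Jb]|r a Rr [Ra Ja]]; split; try by mem subR.
  - exact: JD.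
  - by apply: JM => //; apply: localize_base.
exists s; split=> [g /Js []//|z Jz]; have [r [d [Rr Rd Id zE]]] := JL z Jz.
have rE : r = d * z by rewrite zE; field; apply: neq0.
rewrite zE mulrC; apply: rspanZ => //; first exact: localizeV.
apply: rspan_mono localize_base _; apply: sJ; split=> //.
by rewrite rE; apply: JM => //; apply: localize_base.
Qed.

(** After clearing the denominator [s], the prime [p] divides [a * s]. It cannot divide [s], because
    [p] is in [I] and [s] is not. *)
Lemma localize_dvd p a : prime_elt R p -> I p -> R a -> rdvd (localize R I) p a -> rdvd R p a.
Proof.
move=> [Rp p0 _ pr] Ip Ra [_ [r [s [Rr Rs Is ->]]] aE].
have : rdvd R p (a * s) by exists r => //; rewrite aE; field; apply: neq0.
move=> /pr [] // [c Rc sE]; case: Is; rewrite sE mulrC.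
by case: prI => [[_ _ _ IM] _ _]; apply: IM.
Qed.

Lemma localize_prime p : prime_elt R p -> I p -> prime_elt (localize R I) p.
Proof.
move=> pp Ip; have [Rp p0 np pr] := pp; have subL := localize_subring; split=> //.
- exact: localize_base.
- by move=> /(localize_dvd pp Ip) p1; apply: np; apply: p1; mem subR.
move=> _ _ [r [s [Rr Rs Is ->]]] [r' [s' [Rr' Rs' Is' ->]]] pd.
have : rdvd (localize R I) p (r * r').
  have -> : r * r' = r / s * (r' / s') * (s * s') by field; rewrite !neq0.
  by apply: rdvdMr => //; apply: localize_base; mem subR.
have up b d : R d -> ~ I d -> rdvd R p b -> rdvd (localize R I) p (b / d).
  move=> Rd Id [c Rc ->]; exists (c / d); last by rewrite mulrA.
  by exists c, d.
move=> /(localize_dvd pp Ip) pd'; have /pr [] // : rdvd R p (r * r') by apply: pd'; mem subR.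
  by left; apply: up.
by right; apply: up.
Qed.

End Localize.

(** * The transform of a pair of parameters [p], [q] to [p], [q / p] *)

Section QuadraticTransform.
Variables (K : fieldType) (k : K -> Prop) (fk : is_subfield k).

(** A working form of a two-dimensional regular local ring with parameters [p], [q] and coefficient
    field [k]. The dimension is expressed by two primes that do not divide each other, a condition
    that passes to the transform. *)
Definition regular_pair (R : K -> Prop) (p q : K) :=
  [/\ local2 R p q, noeth R, prime_elt R p /\ prime_elt R q, ~ rdvd R p q /\ ~ rdvd R q p &
      (forall c, k c -> R c) /\ (forall r, R r -> exists c, k c /\ comb R p q (r - c))].

Lemma regular_pairC R p q : regular_pair R p q -> regular_pair R q p.
Proof.
move=> [loc nR [pp pq] [npq nqp] [kR Rk]]; split=> //; first exact: local2C.
by split=> // r /Rk [c [kc /combC cc]]; exists c.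
Qed.

Variables (R : K -> Prop) (p q : K).
Hypothesis reg : regular_pair R p q.

Let t := q / p.
Let A := adjoin R t.
Let I := ideal2 A p t.

Let loc : local2 R p q. Proof. by case: reg. Qed.
Let subR : is_subring R. Proof. by case: loc. Qed.
Let pp : prime_elt R p. Proof. by case: reg => _ _ []. Qed.
Let pq : prime_elt R q. Proof. by case: reg => _ _ []. Qed.
Let npq : ~ rdvd R p q. Proof. by case: reg => _ _ _ []. Qed.
Let nqp : ~ rdvd R q p. Proof. by case: reg => _ _ _ []. Qed.
Let kR c : k c -> R c. Proof. by case: reg => _ _ _ _ [+ _]; apply. Qed.
Let Rk r : R r -> exists c, k c /\ comb R p q (r - c).
Proof. by case: reg => _ _ _ _ [_]; apply. Qed.
Let p0 : p != 0. Proof. by case: pp. Qed.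
Let Rp : R p. Proof. by case: pp. Qed.
Let Rq : R q. Proof. by case: pq. Qed.
Let pt : p * t = q. Proof. by rewrite /t mulrC divfK. Qed.
Let subA : is_subring A. Proof. exact: adjoin_subring. Qed.
Let RA r : R r -> A r. Proof. exact: adjoin_base. Qed.
Let At : A t. Proof. exact: adjoin_gen. Qed.
Let subk : is_subring k. Proof. by case: fk. Qed.

Let clear_denom f n : polyin R f -> (size f <= n.+1)%N -> R (p ^+ n * f.[t]).
Proof.
move=> Rf sf; rewrite horner_coef mulr_sumr; apply: subring_sum => //= i _.
have le : (i <= n)%N by rewrite -ltnS; apply: leq_trans sf.
have -> : p ^+ n * (f`_i * t ^+ i) = f`_i * (p ^+ (n - i) * q ^+ i).
  by rewrite -pt [(p * t) ^+ _]exprMn -{1}(subnK le) exprD; ring.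
by have := Rf i; mem subR.
Qed.

Lemma coef_comb_eq0 c : k c -> comb R p q c -> c = 0.
Proof.
move=> kc cc; apply/eqP/negPn/negP => c0; apply: (unit_not_comb loc) cc.
by split=> //; apply: kR => //; case: fk => _; apply.
Qed.

(** The relations of [t] over [R] come from [p X - q], whose coefficients are in the maximal ideal.
    Clearing denominators shows that [p] divides the leading coefficient of [f], so a multiple of
    [p X - q] lowers the degree. *)
Lemma adjoin_kernel f : polyin R f -> f.[t] = 0 -> forall i, comb R p q f`_i.
Proof.
have c0 : comb R p q 0 by apply: rdvd_comb => //; apply: rdvdr0.
move: {2}(size f) (leqnn (size f)) => n; elim: n f => [|n IH] f.
  by rewrite size_poly_leq0 => /eqP -> _ _ i; rewrite coef0.
case: n IH => [|n] IH sf Rf f0.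
  have fE := size1_polyC sf; rewrite fE hornerC in f0 => i.
  by rewrite fE f0 coefC; case: ifP.
pose c := f`_n.+1; pose g := f - c%:P * 'X^(n.+1).
have Rc : R c by apply: Rf.
have Rg : polyin R g by rewrite /g; pmem subR.
have gE : g.[t] = - (c * t ^+ n.+1).
  by rewrite /g hornerD hornerN hornerM hornerC hornerXn f0 add0r.
have sg : (size g <= n.+1)%N.
  apply: size_sub_lead => //; last by rewrite coefCM coefXn eqxx mulr1.
  by rewrite mul_polyC; apply: leq_trans (size_scale_leq _ _) _; rewrite size_polyXn.
have [e Re cE] : rdvd R p c.
  have : rdvd R p (c * q ^+ n.+1).
    exists (- (p ^+ n * g.[t])); first by apply: subringN => //; apply: clear_denom.
    by rewrite gE -pt [(p * t) ^+ _]exprMn exprS; ring.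
  case: (pp) => _ _ _ pr /pr [] //; first by mem subR.
  by move/(prime_eltX subR pp Rq).
(* This polynomial is [f - e X^n (p X - q)], of smaller degree and still vanishing at [t]. *)
have Ih i : comb R p q (g + (e * q)%:P * 'X^n)`_i.
  apply: IH.
  - apply: leq_trans (size_polyD _ _) _; rewrite geq_max sg /= mul_polyC.
    by apply: leq_trans (size_scale_leq _ _) _; rewrite size_polyXn.
  - by pmem subR.
  - by rewrite hornerD gE hornerM hornerC hornerXn cE -pt exprS; ring.
move=> i; have -> : f`_i = (g + (e * q)%:P * 'X^n)`_i - ((e * q) * ('X^n)`_i - c * ('X^(n.+1))`_i).
  by rewrite /g !(coefD, coefN, coefCM); ring.
apply: combB => //.
have RX m : R ('X^m)`_i by rewrite coefXn; case: eqP => _; mem subR.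
exists (- (e * ('X^(n.+1))`_i)), (e * ('X^n)`_i); split.
- by have := RX n.+1; mem subR.
- by have := RX n; mem subR.
by rewrite cE; ring.
Qed.

(** A power of [p] clears the denominators of the cofactor, and one more [p] turns [t] into [q].
    Thus [q] divides [a] times a power of [p], while it is prime and does not divide [p]. *)
Lemma adjoin_dvd_base a : R a -> rdvd A t a -> rdvd R q a.
Proof.
move=> Ra [_ [f [Rf ->]] aE].
have : rdvd R q (a * p ^+ (size f).+1).
  exists (p ^+ (size f) * f.[t]); first exact: clear_denom.
  by rewrite aE -pt exprS; ring.
case: (pq) => _ _ _ pr /pr [] //; first by mem subR.
by move/(prime_eltX subR pq Rp).
Qed.

(** Since [q = p t], the maximal ideal of [R] falls into [pA], and only the residues in [k] of the
    coefficients survive. *)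
Lemma residue_ex a : A a -> exists F, polyin k F /\ rdvd A p (a - F.[t]).
Proof.
move: a; apply: adjoin_ind.
  by exists 0; rewrite horner0 subrr; split; [apply: polyin0 | apply: rdvdr0].
move=> z r Az [F [kF [d Ad dE]]] Rr; have [c [kc [a [b [Ra Rb cE]]]]] := Rk Rr.
exists (F * 'X + c%:P); split; first by pmem subk.
rewrite hornerD hornerMX hornerC; exists (d * t + a + b * t).
  by have := RA Ra; have := RA Rb; mem subA.
have -> : z * t + r - (F.[t] * t + c) = (z - F.[t]) * t + (r - c) by ring.
by rewrite dE cE -pt; ring.
Qed.

(** With [residue_ex], this identifies [A/pA] with the polynomial ring over [k]: if [F(t) = p g(t)],
    then [F - p g] is in the kernel of evaluation, so the coefficients of [F] are in both [k] and
    the maximal ideal. *)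
Lemma residue_eq0 F : polyin k F -> rdvd A p F.[t] -> F = 0.
Proof.
move=> kF [_ [g [Rg ->]] FE]; apply/polyP => i; rewrite coef0; apply: coef_comb_eq0 => //.
have RF : polyin R F by move=> j; apply: kR.
have -> : F`_i = (F - p%:P * g)`_i + p * g`_i by rewrite coefB coefCM subrK.
apply: combD => //.
  apply: adjoin_kernel; first by pmem subR.
  by rewrite !hornerE FE subrr.
by apply: rdvd_comb => //; apply: rdvd_mulr.
Qed.

Lemma adjoin_prime_l : prime_elt A p.
Proof.
split=> //; first exact: RA.
  rewrite -(hornerC 1 t) => /residue_eq0 F0; have /eqP : (1%:P : {poly K}) = 0.
    by apply: F0; apply: polyinC => //; mem subk.
  by rewrite polyC_eq0 oner_eq0.
move=> a b Aa Ab pab.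
have [F [kF pF]] := residue_ex Aa; have [G [kG pG]] := residue_ex Ab.
have AF : A F.[t] by apply: adjoin_intro => i; apply: kR.
have AG : A G.[t] by apply: adjoin_intro => i; apply: kR.
have /eqP : F * G = 0.
  apply: residue_eq0; first by pmem subk.
  have -> : (F * G).[t] = a * b - ((a - F.[t]) * b + (b - G.[t]) * F.[t]).
    by rewrite hornerM; ring.
  by apply: rdvdB => //; apply: rdvdD => //; apply: rdvdMr.
rewrite mulf_eq0 => /orP [] /eqP FG0; [left | right].
  by rewrite FG0 horner0 subr0 in pF.
by rewrite FG0 horner0 subr0 in pG.
Qed.

Let t0 : t != 0.
Proof. by case: pq => _ q0 _ _; rewrite /t mulf_neq0 // invr_eq0. Qed.

Let const a : A a -> exists2 r, R r & rdvd A t (a - r).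
Proof.
move: a; apply: adjoin_ind; first by exists 0; rewrite ?subrr; [mem subR | apply: rdvdr0].
move=> z r Az _ Rr; exists r => //; rewrite addrK mulrC; exact: rdvd_mulr.
Qed.

(** Every element of [A] is congruent modulo [t] to one of [R], and [adjoin_dvd_base] reduces the
    question to the prime [q] of [R]. *)
Lemma adjoin_prime_r : prime_elt A t.
Proof.
split=> //.
  move/adjoin_dvd_base => t1; case: (pq) => _ _ q1 _; apply/q1/t1; mem subR.
move=> a b Aa Ab tab; have [r Rr tr] := const Aa; have [s Rs ts] := const Ab.
have [rA sA] := (RA Rr, RA Rs).
have : rdvd R q (r * s).
  apply: adjoin_dvd_base; first by mem subR.
  have -> : r * s = a * b - ((a - r) * b + (b - s) * r) by ring.
  by apply: rdvdB => //; apply: rdvdD => //; apply: rdvdMr.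
have up c d : A c -> rdvd A t (c - d) -> rdvd R q d -> rdvd A t c.
  move=> Ac tc [e Re dE]; rewrite -(subrK d c); apply: rdvdD => //.
  by exists (p * e); [have := RA Re; have := RA Rp; mem subA | rewrite dE -pt; ring].
case: (pq) => _ _ _ pr /pr [] // qd; [left; apply: up tr qd | right; apply: up ts qd] => //.
Qed.

Lemma adjoin_ndvd_lr : ~ rdvd A p t.
Proof.
rewrite -(hornerX t) => /residue_eq0 X0; have /eqP : ('X : {poly K}) = 0.
  by apply: X0; apply: polyinX.
by rewrite polyX_eq0.
Qed.

Lemma adjoin_ndvd_rl : ~ rdvd A t p.
Proof. by move/(adjoin_dvd_base Rp). Qed.

Let kA c : k c -> A c. Proof. by move/kR/RA. Qed.

(** Modulo [p] such a relation would read [1 = F X] in the polynomial ring over [k], which fails in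
    degree 0. *)
Let comb1 : ~ comb A p t 1.
Proof.
move=> [a [b [Aa Ab E]]]; have [F [kF [d Ad dE]]] := residue_ex Ab.
have : 1%:P - F * 'X = 0.
  apply: residue_eq0; first by pmem subk.
  exists (a + d * t); first by mem subA.
  rewrite hornerD hornerN hornerMX hornerC E.
  have -> : a * p + b * t - F.[t] * t = a * p + (b - F.[t]) * t by ring.
  by rewrite dE; ring.
move=> /(congr1 (fun h : {poly K} => h`_0)); rewrite coefB coefMX coefC coef0 /= subr0.
by move/eqP; rewrite oner_eq0.
Qed.

Let residue_const a : A a -> exists c, k c /\ comb A p t (a - c).
Proof.
move=> Aa; have [r Rr [d Ad dE]] := const Aa.
have [c [kc [b [b' [Rb Rb' cE]]]]] := Rk Rr; exists c; split=> //.
exists (b + b' * t), d; split=> //; first by have := RA Rb; have := RA Rb'; mem subA.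
by rewrite -(subrK r a) dE -addrA cE -pt; ring.
Qed.

Let comb_coef c : k c -> comb A p t c -> c = 0.
Proof.
move=> kc cc; apply/eqP; apply: contra_notT comb1 => c0; rewrite -(mulVf c0).
by apply: combM => //; apply: kA; case: fk => _; apply.
Qed.

Lemma adjoin_ideal_prime : is_prime_ideal A I.
Proof.
have Ap := RA Rp; split.
- split.
  + by move=> z /ideal2E [a [b [Aa Ab ->]]]; mem subA.
  + by apply/ideal2E; apply: rdvd_comb => //; apply: rdvdr0.
  + by move=> a b /ideal2E ca /ideal2E cb; apply/ideal2E; apply: combD.
  + by move=> r a Ar /ideal2E ca; apply/ideal2E; apply: combM.
- by move/ideal2E.
move=> a b Aa Ab /ideal2E cab; have [c [kc ca]] := residue_const Aa.
have [c' [kc' cb]] := residue_const Ab.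
have /eqP : c * c' = 0.
  apply: comb_coef; first by mem subk.
  have -> : c * c' = a * b - (b * (a - c) + c * (b - c')) by ring.
  by apply: combB => //; apply: combD => //; apply: combM => //; apply: kA.
rewrite mulf_eq0 => /orP [] /eqP E; [left | right]; apply/ideal2E.
  by rewrite E subr0 in ca.
by rewrite E subr0 in cb.
Qed.

(** The conclusion has the form of the hypothesis on [R], so the transform can be iterated: from [D]
    to [alpha], then from [alpha] to [beta]. *)
Lemma regular_pair_transform : regular_pair (localize A I) p t.
Proof.
have subL := localize_subring subA adjoin_ideal_prime; have Ap := RA Rp.
have AL := @localize_base _ _ _ subA adjoin_ideal_prime.
have neq0 s : ~ I s -> s != 0.
  by move=> Is; apply/eqP => s0; apply: Is; rewrite s0; case: adjoin_ideal_prime => [[]].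
have Ip : I p by apply/ideal2E; apply: rdvd_comb => //; apply: rdvdrr.
have It : I t by apply/ideal2E; apply: combC; apply: rdvd_comb => //; apply: rdvdrr.
have IL r s : A s -> ~ I s -> comb A p t r -> comb (localize A I) p t (r / s).
  move=> As Is [a [b [Aa Ab ->]]]; exists (a / s), (b / s); split; last by ring.
    by exists a, s.
  by exists b, s.
split.
- split=> //; first by split; apply: AL.
    move=> [_ [_ [[r [s [Ar As Is ->]]] [r' [s' [Ar' As' Is' ->]]] E]]].
    case: (adjoin_ideal_prime) => _ _ pr; suff /pr [] : I (s * s') by [].
    apply/ideal2E; exists (r * s'), (r' * s); split; try by mem subA.
    by rewrite -[s * s']mulr1 E; field; rewrite !neq0.
  move=> _ [r [s [Ar As Is ->]]]; have [Ir|nIr] := classic (I r).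
    by right; apply: IL => //; apply/ideal2E.
  left; split; [by exists r, s | by rewrite mulf_neq0 ?invr_eq0 ?neq0 |].
  by exists s, r; rewrite invfM invrK mulrC; split.
- apply: (noeth_localize subA adjoin_ideal_prime).
  by apply: noeth_adjoin => //; case: reg.
- split; apply: (localize_prime subA adjoin_ideal_prime) => //.
    exact: adjoin_prime_l.
  exact: adjoin_prime_r.
- split; first by move/(localize_dvd adjoin_ideal_prime adjoin_prime_l Ip At)/adjoin_ndvd_lr.
  by move/(localize_dvd adjoin_ideal_prime adjoin_prime_r It Ap)/adjoin_ndvd_rl.
split; first by move=> c /kA /AL.
move=> _ [r [s [Ar As Is ->]]]; have [c [kc cr]] := residue_const Ar.
have [d [kd ds]] := residue_const As.
have d0 : d != 0.
  by apply/eqP => d0; apply: Is; apply/ideal2E; rewrite d0 subr0 in ds.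
have kd' : k d^-1 by case: fk => _; apply.
exists (c * d^-1); split; first by mem subk.
have -> : r / s - c * d^-1 = (d^-1 * (d * (r - c) - c * (s - d))) / s by field; rewrite d0 neq0.
apply: IL => //; have [kc' kdd] := (kA kc, kA kd).
by apply: combM => //; [apply: kA | apply: combB => //; apply: combM].
Qed.

End QuadraticTransform.

(** * Localizations of factorial rings are Krull domains *)

Section UfdKrull.
Variables (K : fieldType) (R S L : K -> Prop).
Hypotheses (subR : is_subring R) (facR : ufd R) (fracR : forall z, Defs.frac R z).
Hypotheses (SR : forall s, S s -> R s) (S1 : S 1) (S0 : ~ S 0).
Hypothesis (SM : forall s s', S s -> S s' -> S (s * s')).
Hypothesis LE : forall z, L z <-> exists r s, [/\ R r, S s & z = r / s].

(** The [h]-adic valuation as a relation, so that uniqueness and additivity can be proved before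
    existence. *)
Definition valuation_at h z (n : int) := exists a b,
  [/\ R a, R b, ~ rdvd R h a, ~ rdvd R h b & z = h ^ n * (a / b)].

Let ndvd_neq0 h b : ~ rdvd R h b -> b != 0.
Proof. by move=> hb; apply/eqP => b0; apply: hb; rewrite b0; apply: rdvdr0. Qed.

Section Prime.
Variable h : K.
Hypothesis ph : prime_elt R h.
Let h0 : h != 0. Proof. by case: ph. Qed.
Let Rh : R h. Proof. by case: ph. Qed.
Let ndvdM a b : R a -> R b -> ~ rdvd R h a -> ~ rdvd R h b -> ~ rdvd R h (a * b).
Proof. by case: ph => _ _ _ pr Ra Rb ha hb /pr []. Qed.

(** The numerator [r] may be divisible by [h]. This single inequality yields uniqueness, the
    ultrametric inequality and nonnegativity on [L]. *)
Lemma valuation_ge z n m r s : valuation_at h z n -> R r -> R s -> ~ rdvd R h s ->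
  z = h ^ m * (r / s) -> m <= n.
Proof.
move=> [a [b [Ra Rb ha hb zE]]] Rr Rs hs zE'; rewrite leNgt; apply/negP => lt_nm.
apply: (ndvdM Ra Rs ha hs); have [d dE] : exists d : nat, m = n + d.+1%:Z.
  by exists (absz (m - n - 1)%R); lia.
exists (h ^+ d * (r * b)); first by mem subR.
have eqn : h ^ n * (a / b) = h ^ n * (h ^+ d.+1 * (r / s)).
  by rewrite -zE zE' dE expfzDr // -exprnP; ring.
have /(mulfI (expfz_neq0 n h0)) {}eqn := eqn.
have [b0 s0] := (ndvd_neq0 hb, ndvd_neq0 hs).
have -> : a * s = (a / b) * (b * s) by field.
by rewrite eqn exprS; field.
Qed.

Lemma valuation_uniq z n m : valuation_at h z n -> valuation_at h z m -> n = m.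
Proof.
move=> vn vm; apply/le_anti/andP; split.
  by have [a [b [Ra Rb ha hb zE]]] := vn; apply: (valuation_ge vm Ra Rb).
by have [a [b [Ra Rb ha hb zE]]] := vm; apply: (valuation_ge vn Ra Rb).
Qed.

Lemma valuationM z z' n m :
  valuation_at h z n -> valuation_at h z' m -> valuation_at h (z * z') (n + m).
Proof.
move=> [a [b [Ra Rb ha hb ->]]] [a' [b' [Ra' Rb' ha' hb' ->]]].
exists (a * a'), (b * b'); split; try by mem subR.
- exact: ndvdM.
- exact: ndvdM.
by rewrite expfzDr // invfM; ring.
Qed.

Lemma valuationD z z' n m l : valuation_at h z n -> valuation_at h z' m ->
  valuation_at h (z + z') l -> Num.min n m <= l.
Proof.
move=> [a [b [Ra Rb ha hb zE]]] [a' [b' [Ra' Rb' ha' hb' zE']]] vl.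
have split_min (i : int) : Num.min n m <= i -> exists d, h ^ i = h ^ Num.min n m * h ^+ d.
  move=> le; exists (absz (i - Num.min n m)%R).
  by rewrite exprnP -expfzDr //; congr (h ^ _); lia.
have [d dE] : exists d, h ^ n = h ^ Num.min n m * h ^+ d by apply: split_min; rewrite ge_min lexx.
have [d' dE'] : exists d, h ^ m = h ^ Num.min n m * h ^+ d.
  by apply: split_min; rewrite ge_min lexx orbT.
have [b0 b0'] := (ndvd_neq0 hb, ndvd_neq0 hb').
apply: (@valuation_ge (z + z') _ _ (h ^+ d * a * b' + h ^+ d' * a' * b) (b * b') vl).
- by mem subR.
- by mem subR.
- exact: ndvdM.
by rewrite zE zE' dE dE'; field; rewrite b0 b0'.
Qed.

Lemma valuation_self : valuation_at h h 1.
Proof.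
by case: ph => _ _ h1 _; exists 1, 1; split=> //; try mem subR; rewrite divr1 mulr1 expr1z.
Qed.

Lemma prime_dvd_prime p : prime_elt R p -> rdvd R h p -> exists2 e, unit_in R e & p = h * e.
Proof.
move=> [Rp p0 p1 prp] [e Re pE]; exists e => //.
have [||//|[c Rc hE]|[c Rc eE]] := prp h e => //; first by rewrite -pE; apply: rdvdrr.
  apply: unit_dvd1 => //; first by apply: contraNneq p0 => e0; rewrite pE e0 mulr0.
  by exists c => //; apply: (mulfI h0); rewrite mulr1 {1}hE pE; ring.
case: (ph) => _ _ h1 _; case: h1; exists c => //.
by apply: (mulfI p0); rewrite mulr1 {1}pE {1}eE; ring.
Qed.

Lemma multiplicity_ex r : R r -> r != 0 ->
  exists n r', [/\ R r', ~ rdvd R h r' & r = h ^+ n * r'].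
Proof.
move=> Rr r0; have [e [s [Ue ps ->]]] := facR Rr r0; have [Re e0 Re'] := Ue.
elim: s ps => [|p s IH] ps.
  exists 0%N, e; rewrite big_nil expr0 mulr1 mul1r; split=> //.
  by case: (ph) => _ _ h1 _ he; apply: h1; apply: (rdvd_unitl subR Ue); rewrite mulr1.
have [|n [r' [Rr' hr' rE]]] := IH; first by move=> q qs; apply: ps; rewrite inE qs orbT.
have pp := ps p (mem_head _ _); have [Rp _ _ _] := pp.
rewrite big_cons mulrCA rE.
have [/(prime_dvd_prime pp) [d Ud ->]|hp] := classic (rdvd R h p).
  have [Rd _ _] := Ud; exists n.+1, (d * r'); split; first by mem subR.
    by move=> /(rdvd_unitl subR Ud).
  by rewrite exprS; ring.
by exists n, (p * r'); split; [mem subR | exact: ndvdM | ring].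
Qed.

Lemma valuation_ex z : z != 0 -> exists n, valuation_at h z n.
Proof.
have [a [b [Ra Rb b0 ->]]] := fracR z; rewrite mulf_eq0 negb_or => /andP [a0 _].
have [n [a' [Ra' ha' ->]]] := multiplicity_ex Ra a0.
have [m [b' [Rb' hb' ->]]] := multiplicity_ex Rb b0.
exists (n%:Z - m%:Z), a', b'; split=> //.
by rewrite expfzDr // -exprnN -exprnP invfM; ring.
Qed.

(** The convention [v 0 = 0] makes [v] the only such function, which [essential_valuation_eq] relies
    on. *)
Lemma valuation_fun : exists v : K -> int, v 0 = 0 /\ forall z, z != 0 -> valuation_at h z (v z).
Proof.
have H z : exists n : int, if z == 0 then n = 0 else valuation_at h z n.
  by have [_|z0] := eqVneq z 0; [exists 0 | apply: valuation_ex].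
exists (fun z => proj1_sig (constructive_indefinite_description _ (H z))); split.
  by case: constructive_indefinite_description => n /=; rewrite eqxx.
by move=> z /negPf z0; case: constructive_indefinite_description => n /=; rewrite z0.
Qed.

End Prime.

(** Only the primes dividing no element of [S] count: the other ones become units in [L]. *)
Definition essential_valuation (v : K -> int) := exists h,
  [/\ prime_elt R h, (forall s, S s -> ~ rdvd R h s), v 0 = 0 &
      forall z, z != 0 -> valuation_at h z (v z)].

(** Both [h] and [h'] are associates of [p], and a unit factor does not change the order. The Krull
    family is therefore indexed by functions: indexed by primes, it would repeat each valuation for
    all associates and could lose finiteness. *)
Lemma essential_valuation_eq v v' h h' p :
    prime_elt R h -> prime_elt R h' -> prime_elt R p -> rdvd R h p -> rdvd R h' p ->
    v 0 = 0 -> v' 0 = 0 ->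
    (forall z, z != 0 -> valuation_at h z (v z)) ->
    (forall z, z != 0 -> valuation_at h' z (v' z)) ->
  v = v'.
Proof.
move=> ph ph' pp hp h'p v0 v0' vP vP'; apply: functional_extensionality => z.
have [->|z0] := eqVneq z 0; first by rewrite v0 v0'.
have [e Ue pE] := prime_dvd_prime ph pp hp; have [e' Ue' pE'] := prime_dvd_prime ph' pp h'p.
pose d := e' / e; have Ud : unit_in R d by apply: unit_inM => //; apply: unit_inV.
have hE : h = h' * d.
  have [_ e0 _] := Ue; have -> : h = p / e by rewrite pE; field.
  by rewrite pE' /d; ring.
have Ui : unit_in R (d ^ v z).
  case: (v z) => n; rewrite ?NegzE -?exprnN -?exprnP.
    by elim: n => [|n IH]; rewrite ?expr0 ?exprS; [apply: unit_in1 | apply: unit_inM].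
  apply: unit_inV; elim: n.+1 => [|m IH]; rewrite ?expr0 ?exprS; first exact: unit_in1.
  exact: unit_inM.
have [Rdi di0 _] := Ui.
apply: (valuation_uniq ph' _ (vP' z z0)).
have [a [b [Ra Rb ha hb zE]]] := vP z z0; have [Rd d0 Rd'] := Ud.
have dvd_hh' c : rdvd R h' c -> rdvd R h c.
  by move=> [c' Rc' ->]; exists (d^-1 * c'); [mem subR | rewrite hE; field].
exists (d ^ v z * a), b; split=> //; first by mem subR.
- by move/(rdvd_unitl subR Ui)/dvd_hh'.
- by move/dvd_hh'.
by rewrite {1}zE hE expfzMl; ring.
Qed.

Let L_R r : R r -> L r.
Proof. by move=> Rr; apply/LE; exists r, 1; rewrite divr1. Qed.

Let fracL z : Defs.frac L z.
Proof. by have [a [b [Ra Rb b0 ->]]] := fracR z; exists a, b; split=> //; apply: L_R. Qed.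

Let Sneq0 s : S s -> s != 0.
Proof. by move=> Ss; apply/eqP => s0; apply: S0; rewrite -s0. Qed.

Let subL : is_subring L.
Proof.
split.
- by apply: L_R; mem subR.
- by apply: L_R; mem subR.
- move=> a b /LE [r [s [Rr Ss ->]]] /LE [r' [s' [Rr' Ss' ->]]]; apply/LE.
  have [Rs Rs'] := (SR Ss, SR Ss').
  exists (r * s' - r' * s), (s * s'); split; [by mem subR | exact: SM |].
  by field; rewrite !Sneq0.
- move=> a b /LE [r [s [Rr Ss ->]]] /LE [r' [s' [Rr' Ss' ->]]]; apply/LE.
  exists (r * r'), (s * s'); split; [by mem subR | exact: SM |].
  by field; rewrite !Sneq0.
Qed.

Lemma essential_valuation_ge0 z (v : K -> int) :
  L z -> essential_valuation v -> z = 0 \/ 0 <= v z.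
Proof.
move=> /LE [r [s [Rr Ss ->]]] [h [ph hS v0 vP]].
have [->|z0] := eqVneq (r / s) 0; [by left | right].
apply: (valuation_ge ph (vP _ z0) Rr (SR Ss)); first exact: hS.
by rewrite expr0z mul1r.
Qed.

(** Induction on the prime factors of the denominator. A factor [h] either cancels with the
    numerator, or divides some [d] in [S] and is removed by passing to [d * z], or defines an
    essential valuation that is negative at [z]. *)
Lemma valuations_ge0_mem z :
  (forall v, essential_valuation v -> z = 0 \/ 0 <= v z) -> L z.
Proof.
have [a [b [Ra Rb b0 zE]]] := fracR z; have [e [s [Ue ps bE]]] := facR Rb b0.
have [Re e0 Re'] := Ue.
have {zE bE} : z = (a / e) / \prod_(h <- s) h by rewrite zE bE invfM; ring.
have {Ra} : R (a / e) by mem subR.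
move: (a / e) => {}a; clear b Rb b0 e Ue Re e0 Re'.
elim: s a z ps => [|h s IH] a z ps Ra zE vz.
  by apply: L_R; rewrite zE big_nil divr1.
have ps' q : q \in s -> prime_elt R q by move=> qs; apply: ps; rewrite inE qs orbT.
have ph := ps h (mem_head _ _); have [Rh h0 _ prh] := ph.
rewrite big_cons in zE.
have q0 : \prod_(q <- s) q != 0.
  by rewrite prodf_seq_neq0; apply/allP => q /ps' [_ q0 _ _] /=.
have Rq : R (\prod_(q <- s) q).
  rewrite big_seq; apply: big_ind => //; [mem subR | exact: subringM | by move=> q /ps' []].
have [[c Rc aE]|ha] := classic (rdvd R h a).
  by apply: (IH c) => //; rewrite zE aE; field; rewrite q0 h0.
have [[d [Sd [c Rc dE]]]|hS] := classic (exists d, S d /\ rdvd R h d).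
  have d0 := Sneq0 Sd; have Rd := SR Sd.
  have Ld : L (d * z).
    apply: (IH (a * c)) => //; first by mem subR.
      by rewrite zE dE; field; rewrite q0 h0.
    move=> v ev; have [z0|z0] := eqVneq z 0; first by left; rewrite z0 mulr0.
    right; have [g [pg gS v0 vP]] := ev.
    rewrite (valuation_uniq pg (vP (d * z) _) (valuationM pg (vP d d0) (vP z z0))) ?mulf_neq0 //.
    apply: addr_ge0; last by have [/eqP|//] := vz v ev; rewrite (negPf z0).
    by have [/eqP|//] := essential_valuation_ge0 (L_R Rd) ev; rewrite (negPf d0).
  have -> : z = d^-1 * (d * z) by rewrite mulKf.
  apply: subringM => //; apply/LE; exists 1, d; rewrite div1r; split=> //; mem subR.
have [v [v0 vP]] := valuation_fun ph.
have z0 : z != 0.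
  rewrite zE mulf_neq0 ?invr_eq0 ?mulf_neq0 //; exact: (@ndvd_neq0 h).
have ev : essential_valuation v.
  by exists h; split=> // d Sd hd; apply: hS; exists d.
have [/eqP|] := vz v ev; first by rewrite (negPf z0).
have [a' [b' [Ra' Rb' ha' hb' zE']]] := vP z z0.
case: (v z) zE' => // n; rewrite -exprnP => zE' _; exfalso.
have b0' := ndvd_neq0 hb'.
suff /prh [] : rdvd R h (a * b') by [].
exists (h ^+ n * a' * \prod_(q <- s) q); first by mem subR.
have -> : a * b' = z * (h * \prod_(q <- s) q) * b' by rewrite zE; field; rewrite q0 h0.
by rewrite zE'; field.
Qed.

Lemma finitely_many_prime_divisors (s : seq K) : (forall h, h \in s -> prime_elt R h) ->
  exists l : seq {v | essential_valuation v}, forall i h,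
    [/\ prime_elt R h, sval i 0 = 0 & forall z, z != 0 -> valuation_at h z (sval i z)] ->
    rdvd R h (\prod_(q <- s) q) -> List.In i l.
Proof.
elim: s => [|p s IH] ps.
  by exists [::] => i h [[_ _ h1 _] _ _]; rewrite big_nil.
have ps' q : q \in s -> prime_elt R q by move=> qs; apply: ps; rewrite inE qs orbT.
have [l lP] := IH ps'; have pp := ps p (mem_head _ _).
have Rq : R (\prod_(q <- s) q).
  rewrite big_seq; apply: big_ind => //; [mem subR | exact: subringM | by move=> q /ps' []].
have [Rp _ _ _] := pp.
have [[i0 [h0 [[ph0 v00 vP0] hp0]]]|no] := classic (exists (i0 : {v | essential_valuation v}) h0,
   [/\ prime_elt R h0, sval i0 0 = 0 & forall z, z != 0 -> valuation_at h0 z (sval i0 z)]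
   /\ rdvd R h0 p).
  exists (i0 :: l) => i h [ph v0 vP]; rewrite big_cons.
  case: (ph) => _ _ _ pr /pr [] // hd; [left | by right; apply: lP hd].
  have eqv := essential_valuation_eq ph0 ph pp hp0 hd v00 v0 vP0 vP.
  (* The indices pair a function with a proof, so equal functions give equal indices by proof
     irrelevance. *)
  case: i0 i eqv {v00 vP0 v0 vP} => [v0 ev0] [v ev] /= eqv; subst v.
  by congr exist; apply: proof_irrelevance.
exists l => i h [ph v0 vP]; rewrite big_cons.
case: (ph) => _ _ _ pr /pr [] // hd; last exact: lP hd.
by case: no; exists i, h.
Qed.

Lemma ufd_localization_krull : is_krull L.
Proof.
split=> //; exists {v : K -> int | essential_valuation v}, sval; split.
- move=> [v /= [h [ph hS v0 vP]]]; split.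
  + move=> a b _ _ a0 b0; apply: (valuation_uniq ph (vP _ _)); first by rewrite mulf_neq0.
    by apply: valuationM => //; apply: vP.
  + by move=> a b _ _ a0 b0 ab0; apply: (valuationD ph (vP a a0) (vP b b0) (vP _ ab0)).
  + case: (ph) => Rh h0 _ _; exists h; split=> //.
    exact: (valuation_uniq ph (vP h h0) (valuation_self ph)).
- move=> z; split; first by move=> Lz; split=> // -[v ev]; apply: essential_valuation_ge0.
  by move=> [_ vz]; apply: valuations_ge0_mem => v ev; apply: (vz (exist _ v ev)).
move=> z _ z0; have [a [b [Ra Rb b0 zE]]] := fracR z.
have a0 : a != 0 by apply: contraNneq z0 => a0; rewrite zE a0 mul0r.
have [e [s [Ue ps aE]]] := facR Ra a0; have [e' [s' [Ue' ps' bE]]] := facR Rb b0.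
have [l lP] := finitely_many_prime_divisors ps.
have [l' lP'] := finitely_many_prime_divisors ps'.
exists (l ++ l')%list => -[v ev] /= vz; apply/List.in_app_iff.
have [h [ph hS v0 vP]] := ev; apply: NNPP => no; case/eqP: vz.
apply: (valuation_uniq ph (vP z z0)); exists a, b; split=> //; last by rewrite expr0z mul1r.
  move=> ha; apply: no; left; apply: (lP _ h) => //=.
  by apply: (rdvd_unitl subR Ue); rewrite -aE.
move=> hb; apply: no; right; apply: (lP' _ h) => //=.
by apply: (rdvd_unitl subR Ue'); rewrite -bE.
Qed.

End UfdKrull.

(** * The intersection of the rings beta_a *)

Section SyntheticDivision.
Variables (K : fieldType) (R : K -> Prop) (subR : is_subring R).

Lemma polyin_horner f c : polyin R f -> R c -> R f.[c].
Proof.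
move=> Rf Rc; rewrite horner_coef; apply: subring_sum => // i _.
by have := Rf i; mem subR.
Qed.

Lemma polyin_synthetic_division c f : R c -> polyin R f ->
  exists2 g, polyin R g & f = g * ('X - c%:P) + f.[c]%:P.
Proof.
move=> Rc; move: f; apply: polyin_ind => [|f d Rf Rd [g Rg fE]].
  by exists 0; rewrite ?mul0r ?horner0 ?addr0 //; apply: polyin0.
have Rfc := polyin_horner Rf Rc; exists (g * 'X + f.[c]%:P); first by pmem subR.
rewrite {1}fE hornerD hornerMX hornerC polyCD polyCM; ring.
Qed.

End SyntheticDivision.

Lemma prime_elt_ideal (K : fieldType) (R : K -> Prop) p :
  is_subring R -> prime_elt R p -> is_prime_ideal R (rdvd R p).
Proof.
move=> subR [Rp p0 np pr]; split=> //; split.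
- by move=> z [c Rc ->]; mem subR.
- exact: rdvdr0.
- by move=> a b; apply: rdvdD.
- by move=> r a; apply: rdvdMl.
Qed.

(** A root of [f + 1] is no root of [f], hence not in [s]. The extra factor for 0 keeps the degree
    positive when [s] is empty. *)
Lemma alg_closed_infinite (K : fieldType) (k : K -> Prop) (s : seq K) :
  is_subring k -> alg_closed_sub k -> (forall c, c \in s -> k c) ->
  exists b, k b /\ b \notin s.
Proof.
move=> subk ac ks; pose f := \prod_(c <- 0 :: s) ('X - c%:P) : {poly K}.
have fm : f \is monic by apply: monic_prod_XsubC.
have sf : size f = (size s).+2 by rewrite size_prod_XsubC.
have kf : polyin k f.
  rewrite /f big_seq; apply: big_ind.
  - by apply: polyinC => //; mem subk.
  - by move=> g h; apply: polyinM.
  - move=> c; rewrite inE => /predU1P [->|/ks kc]; pmem subk.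
have [||b [kb /eqP]] := ac (f + 1%:P).
- by rewrite -/(polyin k _); pmem subk.
- by rewrite size_polyDl sf // size_polyC oner_neq0.
rewrite hornerD hornerC => fb; exists b; split=> //; apply/negP => bs.
have /eqP fb0 : root f b by rewrite root_prod_XsubC inE bs orbT.
by move/eqP: fb; rewrite fb0 add0r oner_eq0.
Qed.

(** * The rings [alpha] and [beta] over [D] *)

Section Example.
Variables (K : fieldType) (D k : K -> Prop) (x y : K).
Hypotheses (regD : regular_local_dim2 D x y) (cfk : coefficient_field D (ideal2 D x y) k).
Hypothesis ac : alg_closed_sub k.

Let fk : is_subfield k. Proof. by case: cfk. Qed.
Let subk : is_subring k. Proof. by case: fk. Qed.
Let kD c : k c -> D c. Proof. by case: cfk => _ + _ _; apply. Qed.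
Let subD : is_subring D. Proof. by case: regD => [[]]. Qed.
Let Dx : D x. Proof. by case: regD => _ _ []. Qed.
Let Dy : D y. Proof. by case: regD => _ _ []. Qed.
Let k0 : k 0. Proof. by mem subk. Qed.

Let locD : local2 D x y.
Proof.
case: (regD) => _ _ _ [_ mP] _; split=> //.
  move=> /ideal2E m1; have D1 : D 1 by mem subD.
  by case/(mP 1 D1): m1; rewrite invr1 oner_neq0.
move=> r Dr; have [[r0 Dr']|nU] := classic (r != 0 /\ D r^-1); first by left.
by right; apply/ideal2E/mP.
Qed.

Let comb_change a z : k a -> comb D x y z -> comb D y (x + a * y) z.
Proof.
move=> /kD Da [b [c [Db Dc ->]]]; exists (c - b * a), b; split=> //; first by mem subD.
by ring.
Qed.

Let local_change a : k a -> local2 D y (x + a * y).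
Proof.
move=> ka; have Da := kD ka; have [_ _ n1 locr] := locD; split=> //.
- by split; mem subD.
- move=> [b [c [Db Dc E]]]; apply: n1; exists c, (b + c * a); split=> //; first by mem subD.
  by rewrite E; ring.
by move=> r /locr [|/(comb_change ka)]; [left | right].
Qed.

(** The dimension of [D] enters through the middle term [P1] of a chain of primes. It is nonzero, as
    it strictly contains [P0], and it cannot contain both parameters, as it is strictly smaller than
    [P2], which lies in the maximal ideal. *)
Lemma regular_pair_base a : k a -> regular_pair k D y (x + a * y).
Proof.
move=> ka; have loc := local_change ka; have Da := kD ka.
have nD : noeth D by case: regD => /noetherian_noeth.
case: (regD) => _ _ _ _ [[P0 [P1 [P2 [lt01 lt12]]]] _].
case: lt01 => [[[_ P00 _ _] _ _] prP _ [z [P1z P0z]]].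
case: lt12 => [_ prP2 _ [z' [P2z' P1z']]].
have nzP : exists z, P1 z /\ z != 0.
  by exists z; split=> //; apply/eqP => z0; apply: P0z; rewrite z0.
have nm : ~ (P1 y /\ P1 (x + a * y)).
  move=> [Py Pxy]; apply: P1z'.
  have [[P2D _ _ P2M] P21 _] := prP2; have [[_ _ P1D P1M] _ _] := prP.
  have [_ _ _ /(_ z' (P2D _ P2z')) [[_ z0 Dz]|]] := loc.
    by case: P21; rewrite -(mulVf z0); apply: P2M.
  by move=> [b [c [Db Dc ->]]]; apply: P1D; apply: P1M.
have nm' : ~ (P1 (x + a * y) /\ P1 y) by move=> [? ?]; apply: nm.
split=> //.
- split; first exact: (dim2_prime nD prP nzP loc nm).
  exact: (dim2_prime nD prP nzP (local2C loc) nm').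
- have notX p q : ~ rdvd D p (q ^+ 1) -> ~ rdvd D p q by rewrite expr1.
  split; apply: notX; first exact: (dim2_not_nilpotent nD prP nzP loc nm).
  exact: (dim2_not_nilpotent nD prP nzP (local2C loc) nm').
split=> // r Dr; case: cfk => _ _ /(_ r Dr) [c [kc /ideal2E cr]] _.
by exists c; split=> //; apply: comb_change.
Qed.

Let u a := (x + a * y) / y.
Let w a := y ^+ 2 / (x + a * y).
Let al a := alpha D x y a.
Let be a := beta D x y a.

Lemma regular_pair_alpha a : k a -> regular_pair k (al a) y (u a).
Proof. by move=> ka; apply: regular_pair_transform => //; apply: regular_pair_base. Qed.

Let y0 : y != 0.
Proof. by case: (regular_pair_base k0) => _ _ [[]]. Qed.

Let u0 a : k a -> u a != 0.
Proof. by move=> ka; case: (regular_pair_alpha ka) => _ _ [_ []]. Qed.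

Let wE a : k a -> w a = y / u a.
Proof.
move=> /u0; rewrite /w /u mulf_eq0 negb_or => /andP [xy0 _].
by rewrite expr2; field; rewrite xy0 y0.
Qed.

Lemma regular_pair_beta a : k a -> regular_pair k (be a) (u a) (w a).
Proof.
(* The parameters are exchanged because the second transform divides [y] by [u a]. *)
move=> ka; have := regular_pair_transform fk (regular_pairC (regular_pair_alpha ka)).
by rewrite -wE.
Qed.

Let loc_be a : k a -> local2 (be a) (u a) (w a).
Proof. by case/regular_pair_beta. Qed.
Let sub_be a : k a -> is_subring (be a).
Proof. by case/loc_be. Qed.
Let k_be a c : k a -> k c -> be a c.
Proof. by case/regular_pair_beta => _ _ _ _ [+ _]; apply. Qed.
Let sub_al a : k a -> is_subring (al a).
Proof. by case/regular_pair_alpha => [[]]. Qed.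

Let prime_ideal_al a : k a ->
  is_prime_ideal (adjoin D (u a)) (ideal2 (adjoin D (u a)) y (u a)).
Proof. by move=> ka; apply: adjoin_ideal_prime (regular_pair_base ka). Qed.

Let prime_ideal_be a : k a ->
  is_prime_ideal (adjoin (al a) (w a)) (ideal2 (adjoin (al a) (w a)) (u a) (w a)).
Proof.
move=> ka; have := adjoin_ideal_prime fk (regular_pairC (regular_pair_alpha ka)).
by rewrite -wE.
Qed.

Let al_adjoin a z : k a -> adjoin D (u a) z -> al a z.
Proof. by move=> ka; apply: localize_base; [apply: adjoin_subring | apply: prime_ideal_al]. Qed.

Let be_adjoin a z : k a -> adjoin (al a) (w a) z -> be a z.
Proof.
by move=> ka; apply: localize_base; [apply/adjoin_subring/sub_al | apply: prime_ideal_be].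
Qed.

Let be_al a z : k a -> al a z -> be a z.
Proof. by move=> ka az; apply: be_adjoin => //; apply: adjoin_base => //; apply: sub_al. Qed.

Let be_D a z : k a -> D z -> be a z.
Proof. by move=> ka Dz; apply: be_al => //; apply: al_adjoin => //; apply: adjoin_base. Qed.

Let be_u a : k a -> be a (u a).
Proof. by case/loc_be => _ []. Qed.

Let be_w a : k a -> be a (w a).
Proof. by case/loc_be => _ []. Qed.

(** * The valuation ring [V] of the order valuation and its relation to the rings [beta] *)

Let t := x / y.
Let A := adjoin D t.
Let V := localize A (rdvd A y).

Let uE a : u a = t + a.
Proof. by rewrite /u /t; field. Qed.

Let u00 : u 0 = t. Proof. by rewrite uE addr0. Qed.

Let subA : is_subring A. Proof. exact: adjoin_subring. Qed.

Let prAy : prime_elt A y.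
Proof. by have := adjoin_prime_l fk (regular_pair_base k0); rewrite -/(u 0) u00. Qed.

Let prV : is_prime_ideal A (rdvd A y). Proof. exact: prime_elt_ideal. Qed.
Let subV : is_subring V. Proof. exact: localize_subring. Qed.
Let Vy1 : ~ rdvd V y 1.
Proof.
have [_ _ ny _] := prAy; move=> /(localize_dvd prV prAy (rdvdrr subA y)) h; apply: ny; apply: h.
by mem subA.
Qed.
Let prVy : prime_elt V y.
Proof. by apply: localize_prime => //; apply: rdvdrr. Qed.

Let V_unit z : V z -> ~ rdvd V y z -> V z^-1.
Proof.
move=> [r [s [Ar As ys ->]]] nz; exists s, r; rewrite invfM invrK mulrC; split=> //.
move=> [c Ac rE]; apply: nz; exists (c / s); last by rewrite rE; ring.
by exists c, s.
Qed.

Let A_u a : k a -> A (u a).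
Proof.
by move=> /kD Da; rewrite uE; apply: subringD => //; [apply: adjoin_gen | apply: adjoin_base].
Qed.

Let A_adjoin a z : k a -> adjoin D (u a) z -> A z.
Proof.
move=> ka; apply: adjoin_least => //; last exact: A_u.
by move=> r; apply: adjoin_base.
Qed.

Let adjoin_A a z : k a -> A z -> adjoin D (u a) z.
Proof.
move=> ka; have subDu := adjoin_subring (u a) subD; have Da := kD ka.
apply: adjoin_least => //; first by move=> r; apply: adjoin_base.
have -> : t = u a - a by rewrite uE addrK.
by apply: subringB => //; [apply: adjoin_gen | apply: adjoin_base].
Qed.

Let V_A z : A z -> V z. Proof. exact: localize_base. Qed.

Let nyu a : k a -> ~ rdvd V y (u a).
Proof.
move=> ka /(localize_dvd prV prAy (rdvdrr subA y)) yu.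
have := adjoin_ndvd_lr fk (regular_pair_base ka); rewrite -/(u a); apply.
have [c Ac uc] := yu (A_u ka); exists c => //; exact: adjoin_A.
Qed.

Let V_al a z : k a -> al a z -> V z.
Proof.
move=> ka [r [s [Ar As Is ->]]]; exists r, s; split=> //; try exact: (A_adjoin ka).
move=> [c Ac sE]; apply: Is; apply/ideal2E; apply: rdvd_comb; first exact: adjoin_subring.
by exists c => //; apply: adjoin_A.
Qed.

(** In [V] the element [w a] is divisible by [y]. A denominator [s] of [be a] is thus congruent
    modulo [y] to its constant term [r0], a unit of [al a], and so [s] is a unit of [V]. *)
Let V_be a z : k a -> be a z -> V z.
Proof.
move=> ka; have suba := sub_al ka; have Vu : V (u a) by apply/V_A/A_u.
have yw : rdvd V y (w a) by exists (u a)^-1; [apply: V_unit => //; apply: nyu | exact: wE].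
have Vw : V (w a) by have [c Vc ->] := yw; have [Vy _ _ _] := prVy; mem subV.
have V_adj : forall z, adjoin (al a) (w a) z -> V z.
  by apply: adjoin_least => // r; apply: V_al.
case=> r [s [Ar As Is ->]]; apply: subringM; rewrite //; first exact: V_adj.
have : exists r0 r1, [/\ al a r0, adjoin (al a) (w a) r1 & s = r1 * w a + r0].
  move: (s) As; apply: adjoin_ind; last by move=> b c Ab _ ac'; exists c, b.
  exists 0, 0; split; rewrite ?mul0r ?addr0 //; first exact: (subring0 suba).
  by apply: subring0; apply: adjoin_subring.
move=> [r0 [r1 [ar0 Ar1 sE]]].
have Ur0 : unit_in (al a) r0.
  have [[_ _ _ /(_ r0 ar0) [//|[b [c [ab ac' rE]]]]] _ _ _ _] := regular_pair_alpha ka.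
  (* A nonunit [r0] is in [(y, u a)], and [y = u a * w a] puts [s] in the excluded ideal
     [(u a, w a)]. *)
  case: Is; apply/ideal2E; exists (b * w a + c), r1.
  have Aw := adjoin_gen (w a) suba; have subAw := adjoin_subring (w a) suba.
  have Ab := adjoin_base (w a) suba ab; have Ac := adjoin_base (w a) suba ac'.
  split=> //; first by mem subAw.
  have yE : y = u a * w a by rewrite wE // mulrC divfK // u0.
  by rewrite sE rE {1}yE -/(u a) -/(w a); ring.
apply: V_unit; first exact: V_adj.
move=> ys; have [_ r00 ar0'] := Ur0; apply: Vy1; rewrite -(mulfV r00).
apply: rdvdMr => //; first exact: (V_al ka).
have -> : r0 = s - w a * r1 by rewrite sE; ring.
by apply: rdvdB => //; apply: rdvdMr => //; apply: V_adj.
Qed.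

(** A unit of [be a] stays a unit in [V], where [y] is not invertible. *)
Let comb_of_dvd a z : k a -> be a z -> rdvd V y z -> comb (be a) (u a) (w a) z.
Proof.
move=> ka bz yz; have [_ _ _ /(_ z bz) [[_ z0 bz']|//]] := loc_be ka.
by case: Vy1; rewrite -(mulfV z0); apply: rdvdMr => //; apply: (V_be ka).
Qed.

(** * The ring [B], its residues along [y] and its prime ideals *)

Let B z := forall a, k a -> beta D x y a z.

Let subB : is_subring B.
Proof.
split.
- by move=> a /sub_be subb; apply: (subring0 subb).
- by move=> a /sub_be subb; apply: (subring1 subb).
- by move=> b c Bb Bc a ka; apply: (subringB (sub_be ka)); [apply: Bb | apply: Bc].
- by move=> b c Bb Bc a ka; apply: (subringM (sub_be ka)); [apply: Bb | apply: Bc].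
Qed.

Let B_D z : D z -> B z. Proof. by move=> Dz a ka; apply: be_D. Qed.

Let B_t : B t.
Proof.
move=> a ka; have -> : t = u a - a by rewrite uE addrK.
by apply: (subringB (sub_be ka)); [apply: be_u | apply: be_D => //; apply: kD].
Qed.

Let B_adjoin z a : k a -> adjoin D (u a) z -> B z.
Proof.
move=> ka; apply: (@adjoin_least _ D (u a) B subB); first exact: B_D.
by rewrite uE; apply: (subringD subB); [exact: B_t | apply: B_D; apply: kD].
Qed.

Let unit_coeff a c : k a -> k c -> c != 0 -> unit_in (be a) c.
Proof. by move=> ka kc c0; split=> //; apply: k_be => //; case: fk => _; apply. Qed.

Let unit_u a b : k a -> k b -> a <> b -> unit_in (be a) (u b).
Proof.
move=> ka kb ab; have -> : u b = (b - a) + u a by rewrite !uE; ring.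
apply: (unit_add_comb (loc_be ka)); last exact: (comb_l (loc_be ka)).
apply: unit_coeff => //; first by mem subk.
by rewrite subr_eq0; apply/eqP => ba; apply: ab.
Qed.

Let B_w a : k a -> B (w a).
Proof.
move=> ka b kb; have [<-|ba] := eqVneq a b; first exact: be_w.
rewrite wE //; apply: (subringM (sub_be kb)); first exact: be_D.
by have [] : unit_in (be b) (u a) by apply: unit_u => // ab; rewrite ab eqxx in ba.
Qed.

Let B_horner F : polyin k F -> B F.[t].
Proof. by move=> kF; apply: (polyin_horner subB) => // i; apply: B_D; apply: kD. Qed.

(** The point [c] of the line belongs to the index [- c], since [u (- c) = t - c]. *)
Let horner_comb c F : k c -> polyin k F -> F.[c] = 0 ->
  comb (be (- c)) (u (- c)) (w (- c)) F.[t].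
Proof.
move=> kc kF Fc; have kc' : k (- c) by mem subk.
have [G kG ->] := polyin_synthetic_division subk kc kF.
rewrite Fc addr0 hornerM hornerXsubC; apply: combM; first exact: sub_be.
  by apply: B_horner.
by rewrite -uE; apply: (comb_l (loc_be kc')).
Qed.

(* The residue of z along y is a rational function of t which has no pole on the affine line. *)
Lemma residueB z : B z -> exists2 F, polyin k F & rdvd V y (z - F.[t]).
Proof.
move=> Bz.
have Vz : V z by apply: (V_be k0); apply: Bz.
have AV a : rdvd A y a -> rdvd V y a by move=> [c Ac ->]; exists c => //; apply: V_A.
have resA a : A a -> exists F, polyin k F /\ rdvd A y (a - F.[t]).
  by have := residue_ex fk (regular_pair_base k0) (a := a); rewrite -/(u 0) u00.
(* The residue of [z] is written as [F / G] with [G] of least size. A root of [G] would also be a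
   root of [F] and cancel, so [G] is constant. *)
pose Q n := exists F G, [/\ polyin k F, polyin k G, G != 0 & size G = n /\ rdvd V y (G.[t] * z - F.[t])].
have [|n [[F [G [kF kG G0 [sG yGF]]]] minn]] := @least_nat Q.
  have [r [s [Ar As ys zE]]] := Vz; have [F [kF yF]] := resA r Ar; have [G [kG yG]] := resA s As.
  have G0 : G != 0 by apply/eqP => G0; apply: ys; rewrite G0 horner0 subr0 in yG.
  exists (size G), F, G; do 2!split=> //.
  have s0 : s != 0 by apply/eqP => s0; apply: ys; rewrite s0; apply: rdvdr0.
  have -> : G.[t] * z - F.[t] = (r - F.[t]) - (s - G.[t]) * z by rewrite zE; field.
  by apply: rdvdB => //; [apply: AV | apply: rdvdMr => //; apply: AV].
have [G1|G1] := leqP (size G) 1.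
  have GE := size1_polyC G1; have g0 : G`_0 != 0 by rewrite GE polyC_eq0 in G0.
  have kg : k (G`_0)^-1 by case: fk => _; apply.
  exists ((G`_0)^-1%:P * F); first by pmem subk.
  rewrite GE hornerC in yGF; rewrite hornerM hornerC.
  have -> : z - (G`_0)^-1 * F.[t] = (G`_0)^-1 * (G`_0 * z - F.[t]) by field.
  by apply: rdvdMl => //; apply: V_A; apply: adjoin_base => //; apply: kD.
have [c [kc /eqP Gc]] := ac kG G1; have kc' : k (- c) by mem subk.
have subb := sub_be kc'.
(* In [be (- c)] the elements [G.[t]], [G.[t] * z - F.[t]] and [u (- c)] are all in the maximal
   ideal, so the constant [F.[c]] is too. *)
have Fc : F.[c] = 0.
  apply: (coef_comb_eq0 fk (regular_pair_beta kc')); first exact: polyin_horner.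
  have [F1 kF1 FE] := polyin_synthetic_division subk kc kF.
  have -> : F.[c] = G.[t] * z - (G.[t] * z - F.[t]) - F1.[t] * u (- c).
    by rewrite {2}FE hornerD hornerM hornerXsubC hornerC uE; ring.
  have bt H : polyin k H -> be (- c) H.[t] by move=> kH; apply: B_horner.
  apply: combB => //; last first.
    by apply: combM => //; [exact: bt | exact: (comb_l (loc_be kc'))].
  apply: combB => //; first by rewrite mulrC; apply: combM; [| exact: Bz | exact: horner_comb].
  apply: comb_of_dvd => //.
  by apply: (subringB subb); [apply: (subringM subb); [exact: bt | exact: Bz] | exact: bt].
have [F1 kF1 FE] := polyin_synthetic_division subk kc kF.
have [G' kG' GE] := polyin_synthetic_division subk kc kG.
rewrite Fc addr0 in FE; rewrite Gc addr0 in GE.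
have G'0 : G' != 0 by apply: contraNneq G0 => G'0; rewrite GE G'0 mul0r.
have Vp H : polyin k H -> V H.[t] by move=> kH; apply: (V_be k0); apply: B_horner.
have yG' : rdvd V y (G'.[t] * z - F1.[t]).
  have [_ _ _ pr] := prVy.
  have : rdvd V y (u (- c) * (G'.[t] * z - F1.[t])).
    have -> : u (- c) * (G'.[t] * z - F1.[t]) = G.[t] * z - F.[t] => //.
    by rewrite GE FE !hornerM hornerXsubC uE; ring.
  move=> /pr [||/(nyu kc')|] //; first by apply/V_A/A_u.
  by apply: (subringB subV); [apply: (subringM subV) => // |]; apply: Vp.
have : (n <= size G')%N by apply: minn; exists F1, G'.
by rewrite -sG GE size_Mmonic ?monicXsubC // size_XsubC addn2 /= ltnn.
Qed.

(** The residues of elements of [P] are polynomials over [k]. If all vanish, any index works.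
    Otherwise one of least size is not constant, as [P] would contain a unit of [B], and its root is
    a common root of all residues. *)
Lemma primeB_sub P : is_prime_ideal B P ->
  exists a, k a /\ forall z, P z -> comb (be a) (u a) (w a) z.
Proof.
move=> [[PB P0 PD PM] P1 _].
pose Q n := exists z F, [/\ P z, polyin k F, F != 0 & size F = n /\ rdvd V y (z - F.[t])].
have [exQ|nQ] := classic (exists n, Q n); last first.
  exists 0; split=> // z Pz; have [F kF yF] := residueB (PB _ Pz).
  have F0 : F = 0.
    by apply/eqP/negPn/negP => F0; apply: nQ; exists (size F), z, F.
  rewrite F0 horner0 subr0 in yF; apply: comb_of_dvd => //; exact: PB.
have [n [[z [F [Pz kF F0 [sF yF]]]] minn]] := least_nat exQ.
have [F1|F1] := leqP (size F) 1.
  have FE := size1_polyC F1; have f0 : F`_0 != 0 by rewrite FE polyC_eq0 in F0.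
  rewrite FE hornerC in yF.
  have Uz a : k a -> unit_in (be a) z.
    move=> ka; rewrite -(subrK F`_0 z) addrC.
    apply: (unit_add_comb (loc_be ka)); first exact: unit_coeff.
    apply: comb_of_dvd => //; apply: (subringB (sub_be ka)); first exact: PB.
    exact: k_be.
  case: P1; have [_ z0 _] := Uz 0 k0; rewrite -(mulVf z0); apply: PM => //.
  by move=> a /Uz [].
have [c [kc /eqP Fc]] := ac kF F1; have kc' : k (- c) by mem subk.
(* Euclidean division by [F] inside the residues of [P]: subtracting a multiple of [F] cancels the
   leading term of [F'], and below the least size [n] only the zero residue remains. *)
have key m z' (F' : {poly K}) : (size F' <= m)%N -> P z' -> polyin k F' ->
    rdvd V y (z' - F'.[t]) -> F'.[c] = 0.
  elim: m z' F' => [|m IH] z' F' sF' Pz' kF' yF'.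
    by move: sF'; rewrite size_poly_leq0 => /eqP ->; rewrite horner0.
  have [lt|] := ltnP m.+1 n.
    have [->|F'0] := eqVneq F' 0; first by rewrite horner0.
    have : (n <= size F')%N by apply: minn; exists z', F'.
    by move=> le; have := leq_trans le sF'; rewrite leqNgt lt.
  rewrite -sF; move: F1 sF; case: n minn => [|n'] minn F1 sF; first by rewrite sF in F1.
  rewrite sF ltnS => le_nm.
  have lF : F`_n' != 0 by rewrite -[n']/n'.+1.-1 -sF -lead_coefE lead_coef_eq0.
  pose d := F'`_m / F`_n'; pose E := d%:P * 'X^(m - n').
  have kd : k d.
    by apply: (subringM subk); [apply: kF' | case: fk => _; apply].
  have kE : polyin k E by rewrite /E; pmem subk.
  have F'E : F' = (F' - E * F) + E * F by rewrite subrK.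
  rewrite F'E hornerD hornerM Fc mulr0 addr0.
  apply: (IH (z' + - E.[t] * z)).
  - apply: size_sub_lead => //.
      rewrite /E -mulrA mul_polyC; apply: leq_trans (size_scale_leq _ _) _.
      apply: leq_trans (size_polyMleq _ _) _; rewrite size_polyXn sF /=; move: le_nm; lia.
    by rewrite /E -mulrA coefCM coefXnM ltnNge leq_subr /= subKn // /d divfK.
  - apply: PD => //; apply: PM => //; rewrite -hornerN; apply: B_horner; pmem subk.
  - by pmem subk.
  have -> : z' + - E.[t] * z - (F' - E * F).[t] = (z' - F'.[t]) - E.[t] * (z - F.[t]).
    by rewrite hornerD hornerN [(E * F).[t]]hornerM; ring.
  apply: rdvdB => //; apply: rdvdMl => //.
  by apply: (V_be k0); apply: B_horner.
exists (- c); split=> // z' Pz'; have [F' kF' yF'] := residueB (PB _ Pz').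
rewrite -(subrK F'.[t] z'); apply: combD; first exact: sub_be.
  apply: comb_of_dvd => //; apply: (subringB (sub_be kc')); first exact: PB.
  exact: B_horner.
by apply: horner_comb => //; apply: (key _ z' F' (leqnn _)).
Qed.

(** The center of [be a] on [B], that is, the contraction of its maximal ideal. *)
Let M a z := B z /\ comb (be a) (u a) (w a) z.

Let not_comb_unit a z : k a -> be a z -> ~ comb (be a) (u a) (w a) z -> unit_in (be a) z.
Proof. by move=> ka bz nz; case: (loc_be ka) => _ _ _ /(_ z bz) []. Qed.

Let prM a : k a -> is_prime_ideal B (M a).
Proof.
move=> ka; have subb := sub_be ka; split.
- split.
  + by move=> z [].
  + by split; [mem subB | apply: rdvd_comb => //; apply: rdvdr0].
  + by move=> b c [Bb cb] [Bc cc]; split; [mem subB | apply: combD].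
  + by move=> r b Br [Bb cb]; split; [mem subB | apply: combM => //; apply: Br].
- by move=> [_ c1]; case: (loc_be ka).
move=> b c Bb Bc [_ cbc]; apply: NNPP => no.
have Ub : unit_in (be a) b by apply: not_comb_unit => // [|cb]; [exact: Bb | apply: no; left].
have Uc : unit_in (be a) c by apply: not_comb_unit => // [|cb]; [exact: Bc | apply: no; right].
by apply: (unit_not_comb (loc_be ka) (unit_inM subb Ub Uc)).
Qed.

(** The generators of [be a] over [D] are in [B], and each denominator used in building it is a unit
    of [be a]. By [T_inv] the localization at [M a] already inverts these. *)
Lemma beta_localization a z : k a -> be a z <-> localize B (M a) z.
Proof.
move=> ka; have subb := sub_be ka; split; last first.
  move=> [r [s [Br Bs Ms ->]]]; apply: (subringM subb); first exact: Br.
  by have [] : unit_in (be a) s by apply: not_comb_unit => // [|cs]; [exact: Bs | apply: Ms].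
have prMa := prM ka; have subT := localize_subring subB prMa.
have BT := @localize_base _ _ _ subB prMa.
have T_inv s : localize B (M a) s -> unit_in (be a) s -> localize B (M a) s^-1.
  move=> [b [c [Bb Bc Mc ->]]] Us; exists c, b; rewrite invfM invrK mulrC; split=> // -[_ cb].
  have Uc : unit_in (be a) c by apply: not_comb_unit => // [|cs]; [exact: Bc | apply: Mc].
  have [_ c0 _] := Uc; apply: (unit_not_comb (loc_be ka) _ cb).
  by rewrite -(divfK c0 b); apply: unit_inM.
have unit_of s : be a s -> be a s^-1 -> s != 0 -> unit_in (be a) s by [].
have T_al v : al a v -> localize B (M a) v.
  move=> [r [s [Ar As Is ->]]]; apply: (subringM subT); first exact/BT/(B_adjoin ka).
  apply: T_inv; first exact/BT/(B_adjoin ka).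
  apply: unit_of.
  - exact/be_al/al_adjoin.
  - apply: be_al => //; apply: localizeV => //; exact: adjoin_subring.
  - by apply/eqP => s0; apply: Is; rewrite s0; case: (prime_ideal_al ka) => [[]].
have T_adj : forall v, adjoin (al a) (w a) v -> localize B (M a) v.
  by apply: adjoin_least => //; apply/BT/B_w.
move=> [r [s [Ar As Is ->]]]; apply: (subringM subT); first exact: T_adj.
apply: T_inv; first exact: T_adj.
apply: unit_of.
- exact: be_adjoin.
- by apply: localizeV => //; apply/adjoin_subring/sub_al.
- by apply/eqP => s0; apply: Is; rewrite s0; case: (prime_ideal_be ka) => [[]].
Qed.

Lemma almost_krullB : almost_krull B.
Proof.
split=> // P prP; have [a [ka PM]] := primeB_sub prP.
have [[PB P0 PD PZ] P1 pr] := prP; have subb := sub_be ka.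
(* Since [P] lies in [M a], localizing [B] at [P] amounts to inverting the complement of [P] in the
   factorial ring [be a]. *)
apply: (@ufd_localization_krull _ (be a) (fun s => B s /\ ~ P s)) => //.
- have [loc nR [pu _] [nuw _] _] := regular_pair_beta ka.
  exact: (regular_ufd loc nR pu nuw).
- move=> z; case: (regD) => _ /(_ z) [b [c [Db Dc c0 ->]]] _ _ _.
  by exists b, c; split=> //; apply: be_D.
- by move=> s [Bs _]; apply: Bs.
- by split=> //; mem subB.
- by move=> [].
- move=> s s' [Bs Ps] [Bs' Ps']; split; first by mem subB.
  by move/pr => []; auto.
move=> z; split.
  by move=> [r [s [Br Bs Ps ->]]]; exists r, s; split=> //; apply: Br.
move=> [r [s [/(beta_localization _ ka) [b [c [Bb Bc Mc ->]]] [Bs Ps] ->]]].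
exists b, (c * s); split=> //; first by mem subB.
  by move=> /pr [] // Pc; apply: Mc; split=> //; apply: PM.
by rewrite invfM; ring.
Qed.

(** * Failure of the Noetherian property, and irredundance *)

Let inv_u a : k a -> ~ be a (u a)^-1.
Proof.
move=> ka bu; apply: (unit_not_comb (loc_be ka) (e := u a)); last exact: (comb_l (loc_be ka)).
by split=> //; [apply: be_u | apply: u0].
Qed.

(* The ideal of elements divisible by y in all but finitely many beta_a contains every w_a. *)
Lemma not_noetherianB : ~ is_noetherian B.
Proof.
move=> /noetherian_noeth nB.
pose J (s : seq K) z := B z /\ forall a, k a -> a \notin s -> be a (z / y).
have idJ s : is_ideal B (J s).
  split.
  - by move=> z [].
  - split; first by mem subB.
    by move=> a ka _; rewrite mul0r; apply: (subring0 (sub_be ka)).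
  - move=> b c [Bb Jb] [Bc Jc]; split; first by mem subB.
    by move=> a ka sa; rewrite mulrDl; apply: (subringD (sub_be ka)); [apply: Jb | apply: Jc].
  - move=> r b Br [Bb Jb]; split; first by mem subB.
    by move=> a ka sa; rewrite -mulrA; apply: (subringM (sub_be ka)); [apply: Br | apply: Jb].
have J_sub (s s' : seq K) z : {subset s <= s'} -> J s z -> J s' z.
  move=> ss [Bz Jz]; split=> // a ka sa; apply: Jz => //.
  by apply: contra sa; apply: ss.
have [|g [gJ Jg]] := nB (fun z => exists s : seq K, (forall c, c \in s -> k c) /\ J s z).
  split.
  - by move=> z [s [_ []]].
  - by exists [::]; split=> //; case: (idJ [::]).
  - move=> b c [s [ks Jb]] [s' [ks' Jc]]; exists (s ++ s'); split.
      by move=> d; rewrite mem_cat => /orP [/ks|/ks'].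
    have [_ _ JD _] := idJ (s ++ s').
    by apply: JD; [apply: J_sub Jb | apply: J_sub Jc] => d ds; rewrite mem_cat ds ?orbT.
  - by move=> r b Br [s [ks Jb]]; exists s; split=> //; have [_ _ _ JM] := idJ s; apply: JM.
(* Finitely many generators share one finite exceptional set [s]. An index [b] outside [s] then
   forces [w b / y], the inverse of [u b], into [be b]. *)
have [s [ks gs]] : exists s : seq K, (forall c, c \in s -> k c) /\ forall z, z \in g -> J s z.
  elim: g gJ {Jg} => [|h g IH] gJ; first by exists [::].
  have [|s [ks Js]] := IH; first by move=> z zg; apply: gJ; rewrite inE zg orbT.
  have [s' [ks' Js']] := gJ h (mem_head _ _); exists (s ++ s'); split.
    by move=> d; rewrite mem_cat => /orP [/ks|/ks'].
  move=> z; rewrite inE => /predU1P [->|/Js Jz]; [apply: J_sub Js' | apply: J_sub Jz].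
    by move=> d ds; rewrite mem_cat ds orbT.
  by move=> d ds; rewrite mem_cat ds.
have [b [kb bs]] := alg_closed_infinite subk ac ks.
have [_ /(_ b kb bs)] : J s (w b).
  apply: (rspan_sub (idJ s) gs); apply: Jg; exists [:: b]; split.
    by move=> c; rewrite inE => /eqP ->.
  split; first exact: B_w.
  move=> a ka; rewrite inE => ab.
  have -> : w b / y = (u b)^-1 by rewrite wE //; field; rewrite u0 // y0.
  by have [] : unit_in (be a) (u b) by apply: unit_u => // eab; rewrite eab eqxx in ab.
have -> : w b / y = (u b)^-1 by rewrite wE //; field; rewrite u0 // y0.
exact: inv_u.
Qed.

Lemma irredundantB b : k b ->
  ~ (forall z, (forall a, k a -> a <> b -> beta D x y a z) <-> B z).
Proof.
move=> kb /(_ (u b)^-1) [uB _]; apply: (inv_u kb); apply: uB => // a ka ab.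
by have [] := unit_u ka kb ab.
Qed.

Lemma essentialB a : k a ->
  exists Q, is_prime_ideal B Q /\ forall z, beta D x y a z <-> localize B Q z.
Proof. by move=> ka; exists (M a); split=> [|z]; [apply: prM | apply: beta_localization]. Qed.

End Example.

Theorem theorem6p15 (K : fieldType) (D k : K -> Prop) (x y : K) :
  regular_local_dim2 D x y ->
  coefficient_field D (ideal2 D x y) k ->
  alg_closed_sub k ->
  let B := fun z => forall a, k a -> beta D x y a z in
  [/\ almost_krull B,
      ~ is_noetherian B,
      (* irredundant *)
      (forall b, k b ->
         ~ (forall z, (forall a, k a -> a <> b -> beta D x y a z) <-> B z)) &
      (* essential *)
      (forall a, k a -> exists Q, is_prime_ideal B Q /\
                        forall z, beta D x y a z <-> localize B Q z)].
Proof.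
move=> regD cfk ac B; split.
- exact: (almost_krullB regD cfk ac).
- exact: (not_noetherianB regD cfk ac).
- by move=> b kb; apply: (irredundantB regD cfk).
- by move=> a ka; apply: (essentialB regD cfk).
Qed.
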